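(* Let $m\ge 1$ be an integer and let $\mathcal{X}\subset\mathbb{C}$ be a signal constellation with $|\mathcal{X}|=2^m$, equipped with a binary labeling (a bijection $\mathcal{X}\to\{0,1\}^m$). For $i\in\{1,\dots,m\}$ and $b\in\{0,1\}$ let $\mathcal{X}_b^i\subset\mathcal{X}$ be the set of points whose label has bit $b$ in position $i$. Let $I^{\rm bicm}_{\mathcal{X}}(\mathsf{snr})$ be the BICM mutual information (defined in the context). Then for every $\mathsf{snr}>0$, $$\frac{d\,I^{\rm bicm}_{\mathcal{X}}(\mathsf{snr})}{d\,\mathsf{snr}}=\sum_{i=1}^m\frac12\sum_{b=0}^1\left(\mathsf{mmse}_{\mathcal{X}}(\mathsf{snr})-\mathsf{mmse}_{\mathcal{X}_b^i}(\mathsf{snr})\right),$$ where, for a finite nonempty set $\mathcal{A}\subset\mathbb{C}$, $$\mathsf{mmse}_{\mathcal{A}}(\mathsf{snr})=\mathbb{E}[|A|^2]-\frac{1}{|\mathcal{A}|}\sum_{a\in\mathcal{A}}\int_{\mathbb{C}}\frac1\pi\left|\frac{\sum_{a'\in\mathcal{A}}a'\,e^{-|\sqrt{\mathsf{snr}}(a-a')+z|^2}}{\sum_{a'\in\mathcal{A}}e^{-|\sqrt{\mathsf{snr}}(a-a')+z|^2}}\right|^2e^{-|z|^2}\,dz,$$ with $A$ uniformly distributed on $\mathcal{A}$, is the minimum mean-squared error of the input constellation $\mathcal{A}$, that is, the minimum mean-squared error $\mathbb{E}\big[|A-\mathbb{E}[A\mid Y]|^2\big]$ in estimating $A$ from $Y=\sqrt{\mathsf{snr}}\,A+Z$,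 where $Z\sim\mathcal{N}_{\mathbb{C}}(0,1)$ is independent of $A$.
   Context: $\mathcal{N}_{\mathbb{C}}(0,1)$ is the circularly symmetric complex Gaussian distribution with density $\frac1\pi e^{-|z|^2}$ on $\mathbb{C}$ with respect to Lebesgue measure $dz$ on $\mathbb{C}\cong\mathbb{R}^2$. All logarithms are natural. Constellations need not have zero mean or unit variance. With $\mathcal{X}$, $m$ and $\mathcal{X}_b^i$ as in the claim (so each $\mathcal{X}_b^i$ has $2^{m-1}$ elements), the BICM (bit-interleaved coded modulation) mutual information over the channel $Y=\sqrt{\mathsf{snr}}\,X+Z$ with non-iterative decoding is $$I^{\rm bicm}_{\mathcal{X}}(\mathsf{snr})=\sum_{i=1}^m\mathbb{E}\left[\log\frac{\sum_{x'\in\mathcal{X}_B^i}e^{-|\sqrt{\mathsf{snr}}(X-x')+Z|^2}}{\frac12\sum_{x'\in\mathcal{X}}e^{-|\sqrt{\mathsf{snr}}(X-x')+Z|^2}}\right],$$ where, in the $i$-th term, $B$ is uniform on $\{0,1\}$, $X$ is uniform on $\mathcal{X}_B^i$ given $B$, and $Z\sim\mathcal{N}_{\mathbb{C}}(0,1)$ is independent of $(B,X)$. *)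

(* Defs.v *)
From HB Require Import structures.
From mathcomp Require Import all_boot all_order all_algebra finmap complex.
From mathcomp Require Import all_classical all_reals all_analysis.

Set Implicit Arguments.
Unset Strict Implicit.
Unset Printing Implicit Defensive.

Import Order.TTheory GRing.Theory Num.Theory.
Import numFieldNormedType.Exports.

Local Open Scope classical_set_scope.
Local Open Scope complex_scope.
Local Open Scope ring_scope.

(* Borel structure on the complex plane, transported from R * R.  Real-closed
   equips R[i] with algebra only, so it has to be declared here. *)
Section complex_borel.
Variable R : realType.

Definition complex_to_pair (z : R[i]) : measurableTypeR R * measurableTypeR R :=
  (complex.Re z, complex.Im z).

Definition complex_of_pair (p : measurableTypeR R * measurableTypeR R) : R[i] :=
  p.1 +i* p.2.

Definition complex_borel : set (set R[i]) :=
  preimage_set_system setT complex_to_pair measurable.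

Let complex_borel_sigma : sigma_algebra setT complex_borel.
Proof. exact/sigma_algebra_preimage/sigma_algebra_measurable. Qed.

Let complex_borel0 : complex_borel set0.
Proof. by case: complex_borel_sigma. Qed.

Let complex_borelC A : complex_borel A -> complex_borel (~` A).
Proof. by case: complex_borel_sigma => _ + _ => /[apply]; rewrite setTD. Qed.

Let complex_borel_bigcup (F : (set R[i])^nat) :
  (forall k, complex_borel (F k)) -> complex_borel (\bigcup_k F k).
Proof. by case: complex_borel_sigma => _ _; apply. Qed.

HB.instance Definition _ := isPointed.Build R[i] 0.
HB.instance Definition _ := @isMeasurable.Build (preimage_display complex_to_pair)
  R[i] complex_borel complex_borel0 complex_borelC complex_borel_bigcup.

End complex_borel.

Notation abs2 z := (ComplexField.Normc.normc z ^+ 2).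

(* Lebesgue measure dz on the plane, on pairs (x, y) with z = x + i y. *)
Notation lebesgue2 R := (@lebesgue_measure R \x @lebesgue_measure R)%E.

Section gaussian_channel.
Variable R : realType.

Definition cgauss_pdf (z : R[i]) : R := pi^-1 * expR (- abs2 z).

Definition channel_weight (snr : R) (a z a' : R[i]) : R :=
  expR (- abs2 ((Num.sqrt snr)%:C * (a - a') + z)).

(* E[A | Y = sqrt snr * a + z] for A uniform on the constellation. *)
Definition posterior_mean (A : {fset R[i]}) (snr : R) (a z : R[i]) : R[i] :=
  (\sum_(a' <- A) a' * (channel_weight snr a z a')%:C) /
  (\sum_(a' <- A) channel_weight snr a z a')%:C.

Definition mmse (A : {fset R[i]}) (snr : R) : R :=
  (#|` A|%:R)^-1 * (\sum_(a <- A) abs2 a) -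
  (#|` A|%:R)^-1 * \sum_(a <- A)
    \int[lebesgue2 R]_p
      (pi^-1 * abs2 (posterior_mean A snr a (complex_of_pair p)) *
       expR (- abs2 (complex_of_pair p))).

End gaussian_channel.

Section random_variables.
Context d (T : measurableType d) (R : realType) (P : probability T R).

Definition cgaussian (Z : T -> R[i]) := forall D : set R[i], measurable D ->
  P (Z @^-1` D) =
  (\int[lebesgue2 R]_(p in @complex_of_pair R @^-1` D)
    (cgauss_pdf (complex_of_pair p))%:E)%E.

Definition uniform_on (A : {fset R[i]}) (X : T -> R[i]) :=
  forall a, a \in A -> P (X @^-1` [set a]) = ((#|` A|%:R)^-1)%:E.

Definition independent_rv d1 d2 (T1 : measurableType d1) (T2 : measurableType d2)
    (X : T -> T1) (Y : T -> T2) :=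
  forall (D : set T1) (E : set T2), measurable D -> measurable E ->
  P (X @^-1` D `&` Y @^-1` E) = (P (X @^-1` D) * P (Y @^-1` E))%E.

(* M is a version of E[A | Y]; the conditions are componentwise in Re and Im. *)
Definition is_cond_expectation (A Y M : T -> R[i]) :=
  [/\ @measurable_fun _ _ (g_sigma_algebra_preimageType Y) R[i] setT M,
      P.-integrable setT (fun w => (complex.Re (M w))%:E),
      P.-integrable setT (fun w => (complex.Im (M w))%:E) &
      forall G, g_sigma_algebra_preimage Y G ->
        (\int[P]_(w in G) (complex.Re (M w))%:E = \int[P]_(w in G) (complex.Re (A w))%:E)%E /\
        (\int[P]_(w in G) (complex.Im (M w))%:E = \int[P]_(w in G) (complex.Im (A w))%:E)%E].

End random_variables.

Section bicm.
Variables (R : realType) (m : nat) (X : {fset R[i]}) (label : X -> m.-tuple bool).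

Definition subconstellation (i : 'I_m) (b : bool) : {fset R[i]} :=
  [fsetval x : X | tnth (label x) i == b]%fset.

Section model.
Context d (T : measurableType d) (P : probability T R).

(* The uniform law of S given B = b is written with P(B = b) multiplied out. *)
Definition bicm_inputs (i : 'I_m) (B : T -> bool) (S Z : T -> R[i]) :=
  [/\ forall b, P (B @^-1` [set b]) = (2^-1)%:E,
      forall b x, x \in subconstellation i b ->
        P (B @^-1` [set b] `&` S @^-1` [set x]) =
        (P (B @^-1` [set b]) * ((#|` subconstellation i b|%:R)^-1)%:E)%E,
      cgaussian P Z &
      independent_rv P (fun w => (B w, S w)) Z].

Definition bicm_term (i : 'I_m) (B : T -> bool) (S Z : T -> R[i]) (snr : R) : R :=
  fine 'E_P[fun w =>
    (ln ((\sum_(x' <- subconstellation i (B w)) channel_weight snr (S w) (Z w) x') /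
        (2^-1 * \sum_(x' <- X) channel_weight snr (S w) (Z w) x')))%R].

End model.

(* The joint law of (B, X, Z) depends on i, hence one sample space per bit. *)
Definition bicm_mutual_info d (T : 'I_m -> measurableType d)
    (P : forall i, probability (T i) R) (B : forall i, T i -> bool)
    (S Z : forall i, T i -> R[i]) (snr : R) : R :=
  \sum_(i < m) bicm_term (P i) i (B i) (S i) (Z i) snr.

End bicm.

(* Main.v *)
(* Let E_c[f] = \int f(y) (1/pi) exp(-|y - c|^2) dy and, for a finite family A, let
   p(y) = \sum_(a in A) exp(-|y - s a|^2) and <g>(y) the average of g : A -> R with
   weights exp(-|y - s a|^2), i.e. the posterior mean of g given Y = y.  Since
   \sum_a exp(-|y - s a|^2) <g>(y) = \sum_a g(a) exp(-|y - s a|^2), these satisfy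
   the tower property
     \sum_a g(a) E_(s a)[f] = \sum_a E_(s a)[f <g>].
   Each bit contributes 1/2 \sum_b I(X_b^i) - I(X) + ln 2 to the mutual information,
   with I(A) = 1/|A| \sum_a E_(s a)[ln p].  Writing y = s a + z and differentiating
   in s under the integral sign, d/ds I(A) is the mean of
     -2 <(a - a').(y - s a')>,  the average being over a';
   by the tower property the terms a.y and <a'>.y cancel and the rest is
   -2 s (E|A|^2 - E|<a>|^2) = -2 s mmse; no integration by parts is needed.
   The chain rule with s = sqrt snr turns this into -mmse.  The tower property also
   shows that <a>(Y) is a version of E[A | Y] and that its mean-squared error is
   E|A|^2 - E|<a>|^2. *)
Require Import Defs.
From HB Require Import structures.
From mathcomp Require Import all_boot all_order all_algebra finmap complex.
From mathcomp Require Import all_classical all_reals all_analysis.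
From mathcomp Require Import measurable_realfun ring lra.

Set Implicit Arguments.
Unset Strict Implicit.
Unset Printing Implicit Defensive.

Import Order.TTheory GRing.Theory Num.Theory.
Import numFieldNormedType.Exports.

Local Open Scope classical_set_scope.
Local Open Scope complex_scope.
Local Open Scope ring_scope.

(** * Lebesgue measure and Gaussian integrals on the complex plane *)

Section lebesgue_plane.
Variable R : realType.
Local Notation mu := (@lebesgue_measure R).
Local Notation cp := (@complex_of_pair R).

(** The image of Lebesgue measure under a translation still gives half-open intervals their length,
    and Lebesgue measure is the only measure that does. *)
Lemma lebesgue_measure_shift (c : R) (A : set R) : measurable A ->
  mu ((fun x => x + c) @^-1` A) = mu A.
Proof.
have mc : measurable_fun setT (fun x : measurableTypeR R => x + c : measurableTypeR R).
  exact: measurable_funD.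
pose f : {mfun measurableTypeR R >-> measurableTypeR R} := HB.pack
  (fun x : measurableTypeR R => x + c : measurableTypeR R)
  (isMeasurableFun.Build _ _ _ _ _ mc).
move=> mA; apply/esym.
apply: (lebesgue_measure_unique (mu := pushforward mu f)) => //= _ [[a b]] _ <-.
rewrite /pushforward.
have -> : f @^-1` `]a, b] = `]a - c, b - c]%classic.
  by apply/seteqP; split=> x /=; rewrite !in_itv/= ltrBlDr lerBrDr.
rewrite !lebesgue_measure_itv/= !lte_fin ltrD2r.
by case: ifP => // _; rewrite -!EFinB opprB addrA subrK.
Qed.

Let shift2 (c : R[i]) (p : measurableTypeR R * measurableTypeR R) :
  measurableTypeR R * measurableTypeR R :=
  (p.1 + complex.Re c, p.2 + complex.Im c).

Let measurable_shift2 c : measurable_fun setT (shift2 c).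
Proof.
apply: (@measurable_fun_pair _ _ _ _ (measurableTypeR R) (measurableTypeR R)).
  by apply: measurable_funD => //; exact: measurable_fst.
by apply: measurable_funD => //; exact: measurable_snd.
Qed.

(** Same principle in the plane: a product measure is determined by its values on rectangles, where
    the one-dimensional invariance applies to each side. *)
Let lebesgue2_shift (c : R[i]) A : measurable A ->
  pushforward (lebesgue2 R) (shift2 c) A = lebesgue2 R A.
Proof.
move=> mA; pose f : {mfun _ >-> _} := HB.pack (shift2 c)
  (isMeasurableFun.Build _ _ _ _ _ (measurable_shift2 c)).
apply/esym/(@product_measure_unique _ _ _ _ _ mu mu (pushforward (lebesgue2 R) f)) => //.
move=> {mA}A B mA mB.
pose shift_set c0 (D : set R) : set (measurableTypeR R) := (fun x : R => x + c0) @^-1` D.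
transitivity (mu (shift_set (complex.Re c) A) * mu (shift_set (complex.Im c) B))%E.
  rewrite -product_measure1E//;
    by rewrite /shift_set -[X in measurable X]setTI; apply: measurable_funD.
by congr (_ * _)%E; exact: lebesgue_measure_shift.
Qed.

Lemma measurable_Re : measurable_fun setT (fun z : R[i] => complex.Re z).
Proof.
move=> _ D mD; exists (D `*` setT); first exact: measurableX.
by rewrite !setTI; apply/seteqP; split=> z /=; [case|].
Qed.

Lemma measurable_Im : measurable_fun setT (fun z : R[i] => complex.Im z).
Proof.
move=> _ D mD; exists (setT `*` D); first exact: measurableX.
by rewrite !setTI; apply/seteqP; split=> z /=; [case|].
Qed.

Lemma measurable_set1_complex (a : R[i]) : measurable [set a].
Proof.
exists ([set complex.Re a] `*` [set complex.Im a]); first exact: measurableX.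
rewrite setTI; apply/seteqP; split=> z /=; last by move=> ->.
by case: z a => [? ?] [? ?] /= [-> ->].
Qed.

(** Measurable sets of [R[i]] are by construction preimages of measurable sets of pairs, so
    measurability of the pair of components is enough. *)
Lemma measurable_fun_complex d (T : measurableType d) (f : T -> R[i]) :
  measurable_fun setT (fun t => complex.Re (f t)) ->
  measurable_fun setT (fun t => complex.Im (f t)) ->
  measurable_fun setT f.
Proof.
move=> mr mi _ _ [D mD <-].
have := measurable_fun_pair mr mi measurableT mD.
by rewrite !setTI.
Qed.

Lemma measurable_complex_of_pair : measurable_fun setT cp.
Proof.
by apply: measurable_fun_complex; [exact: measurable_fst|exact: measurable_snd].
Qed.

(** For nonnegative functions this is a change of variables along a measure-preserving map. The
    general case treats positive and negative parts separately, so no integrability is assumed. *)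
Lemma integral_lebesgue2_shift (c : R[i]) (f : R[i] -> \bar R) :
  measurable_fun setT f ->
  (\int[lebesgue2 R]_p f (cp p + c)%R = \int[lebesgue2 R]_p f (cp p))%E.
Proof.
have ge0 (g : R[i] -> \bar R) : measurable_fun setT g -> (forall z, 0 <= g z)%E ->
  (\int[lebesgue2 R]_p g (cp p + c)%R = \int[lebesgue2 R]_p g (cp p))%E.
  move=> mg g0.
  transitivity (\int[pushforward (lebesgue2 R) (shift2 c)]_p g (cp p))%E.
    rewrite (ge0_integral_pushforward (measurable_shift2 c)) //.
    - apply: eq_integral => -[x y] _; congr g.
      by rewrite /cp /shift2 /=; case: c.
    - exact: measurableT_comp mg measurable_complex_of_pair.
  pose h : {mfun _ >-> _} := HB.pack (shift2 c)
    (isMeasurableFun.Build _ _ _ _ _ (measurable_shift2 c)).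
  apply: (@eq_measure_integral _ _ _ _ (lebesgue2 R) (pushforward (lebesgue2 R) h)).
  by move=> A mA _; exact: lebesgue2_shift.
move=> mf.
have parts (T : Type) (g : T -> R[i]) :
    (f \o g)^\+%E = f^\+%E \o g /\ (f \o g)^\-%E = f^\-%E \o g.
  by rewrite funepos_comp funeneg_comp.
pose s p := cp p + c.
rewrite -[LHS]/(\int[lebesgue2 R]_p (f \o s) p)%E -[RHS]/(\int[lebesgue2 R]_p (f \o cp) p)%E.
rewrite [LHS]integralE [RHS]integralE.
have [-> ->] := parts _ s; have [-> ->] := parts _ cp.
congr (_ - _)%E.
- exact: (ge0 _ (measurable_funepos mf) (funepos_ge0 f)).
- exact: (ge0 _ (measurable_funeneg mf) (funeneg_ge0 f)).
Qed.

End lebesgue_plane.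

(** * Gaussian means of functions of quadratic growth *)

Section gaussian_integrals.
Variable R : realType.
Local Notation cp := (@complex_of_pair R).
Local Notation lam := (lebesgue2 R).
Implicit Types (z c : R[i]) (f g : R[i] -> R).

Lemma abs2E z : abs2 z = complex.Re z ^+ 2 + complex.Im z ^+ 2.
Proof. by case: z => x y; rewrite /= sqr_sqrtr// addr_ge0// sqr_ge0. Qed.

Lemma abs2_ge0 z : 0 <= abs2 z. Proof. exact: sqr_ge0. Qed.

Lemma measurable_abs2 : measurable_fun setT (fun z : R[i] => abs2 z).
Proof.
under eq_fun do rewrite abs2E.
by apply: measurable_funD; apply: measurable_funX;
  [exact: measurable_Re|exact: measurable_Im].
Qed.

Lemma measurable_addc c : measurable_fun setT (fun z : R[i] => z + c).
Proof.
apply: measurable_fun_complex.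
- under eq_fun do rewrite raddfD.
  by apply: measurable_funD => //; exact: measurable_Re.
- under eq_fun do rewrite raddfD.
  by apply: measurable_funD => //; exact: measurable_Im.
Qed.

Lemma measurable_cgauss_pdf : measurable_fun setT (@cgauss_pdf R).
Proof.
apply: measurable_funM => //; apply: measurableT_comp => //.
by apply: measurable_funN; exact: measurable_abs2.
Qed.

Lemma cgauss_pdf_gt0 z : 0 < cgauss_pdf z.
Proof. by rewrite mulr_gt0 ?invr_gt0 ?pi_gt0 ?expR_gt0. Qed.

Let integral_prod_normal (s : R) :
  (\int[lam]_p (normal_pdf 0 s p.1 * normal_pdf 0 s p.2)%:E = 1)%E.
Proof.
have m1 := @measurable_normal_pdf R 0 s.
rewrite fubini_tonelli1.
- rewrite /fubini_F /=.
  under eq_integral => x _.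
    under eq_integral do rewrite EFinM.
    rewrite ge0_integralZl_EFin ?normal_pdf_ge0//; first last.
      exact/measurable_EFinP.
      by move=> y _; rewrite lee_fin normal_pdf_ge0.
    rewrite integral_normal_pdf mule1.
    over.
  exact: integral_normal_pdf.
- apply/measurable_EFinP; apply: measurable_funM.
    exact: measurableT_comp m1 measurable_fst.
  exact: measurableT_comp m1 measurable_snd.
- by move=> x; rewrite lee_fin mulr_ge0 ?normal_pdf_ge0.
Qed.

Lemma integral_cgauss_pdf : (\int[lam]_p (cgauss_pdf (cp p))%:E = 1)%E.
Proof.
(* Each of the two components has variance 1/2, which makes the exponents [x^2 / (2 s^2)] equal to
   [x^2]. *)
rewrite -(integral_prod_normal (Num.sqrt 2^-1)); apply: eq_integral => -[x y] _.
have s2 : Num.sqrt (2^-1 : R) ^+ 2 = 2^-1 by rewrite sqr_sqrtr// invr_ge0.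
have s0 : Num.sqrt (2^-1 : R) != 0 by rewrite gt_eqF// sqrtr_gt0 invr_gt0.
congr EFin; rewrite normal_pdfE// /normal_peak /normal_fun s2 !subr0 /cgauss_pdf abs2E/=.
have -> : 2^-1 * pi *+ 2 = pi :> R by rewrite -mulr_natr; field.
have -> : 2^-1 *+ 2 = 1 :> R by rewrite -mulr_natr; field.
rewrite !divr1 opprD expRD mulrACA -invfM -expr2 sqr_sqrtr// pi_ge0//.
Qed.

(** With [t = abs2 z], [1 + t <= 2 * (1 + t / 2) <= 2 * expR (t / 2)]. Hence the integrand is at
    most [2 / pi * expR (- t / 2)], which is 4 times the product of two standard normal
    densities. *)
Lemma integrable_cgauss_quad :
  lam.-integrable setT (fun p => ((1 + abs2 (cp p)) * cgauss_pdf (cp p))%:E).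
Proof.
have m1 := @measurable_normal_pdf R 0 1.
apply: (le_integrable _ (g := fun p : measurableTypeR R * measurableTypeR R =>
   (4%:E * (normal_pdf 0 1 p.1 * normal_pdf 0 1 p.2)%:E)%E)) => //.
- apply/measurable_EFinP; apply: measurable_funM.
    apply: measurable_funD => //.
    exact: measurableT_comp measurable_abs2 (@measurable_complex_of_pair R).
  exact: measurableT_comp measurable_cgauss_pdf (@measurable_complex_of_pair R).
- move=> -[x y] _; rewrite -EFinM !abse_EFin lee_fin.
  rewrite ger0_norm; last by rewrite mulr_ge0 ?(ltW (cgauss_pdf_gt0 _))// addr_ge0// abs2_ge0.
  rewrite ger0_norm; last by rewrite !mulr_ge0// normal_pdf_ge0.
  rewrite normal_pdfE// /normal_peak /normal_fun !subr0 /cgauss_pdf abs2E/=.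
  rewrite expr1n mul1r mulrACA -invfM -expr2 sqr_sqrtr; last exact: mulrn_wge0 (pi_ge0 _).
  rewrite -expRD -mulrDl -opprD; set t := x ^+ 2 + y ^+ 2.
  have -> : 4 * ((pi *+ 2)^-1 * expR (- t / 2)) = pi^-1 * (2 * expR (- t / 2)) :> R.
    by rewrite -(mulr_natr pi) invfM; move: pi^-1 => q; field.
  rewrite mulrCA ler_pM2l ?invr_gt0 ?pi_gt0//.
  have -> : expR (- t) = expR (- t / 2) * expR (- t / 2) by rewrite -expRD; congr expR; field.
  rewrite mulrA ler_pM2r ?expR_gt0// mulNr expRN ler_pdivrMr ?expR_gt0//.
  by have := expR_ge1Dx (t / 2); lra.
- apply: integrableZl => //; apply/integrableP; split.
    apply/measurable_EFinP; apply: measurable_funM.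
      exact: measurableT_comp m1 measurable_fst.
    exact: measurableT_comp m1 measurable_snd.
  under eq_integral do rewrite abse_EFin ger0_norm ?mulr_ge0 ?normal_pdf_ge0//.
  by rewrite integral_prod_normal ltry.
Qed.

(** A class stable under sums, translations and products with bounded measurable functions,
    containing the log-evidence and the score, and integrable against every translated Gaussian. It
    discharges all integrability conditions below. *)
Definition quad_growth f := measurable_fun setT f /\
  exists C, forall z, `|f z| <= C * (1 + abs2 z).

(** The density is translated rather than the argument of [f], so that means around different
    centres can be added under one integral. *)
Definition gauss_mean c f : R := \int[lam]_p (f (cp p) * cgauss_pdf (cp p - c)).

Lemma quad_growth_cst (k : R) : quad_growth (fun=> k).
Proof.
split; first exact: measurable_cst.
exists `|k| => z; rewrite ler_peMr// lerDl; exact: abs2_ge0.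
Qed.

Lemma quad_growth_le f g : measurable_fun setT f -> quad_growth g ->
  (forall z, `|f z| <= `|g z|) -> quad_growth f.
Proof.
by move=> mf [_ [C gC]] fg; split => //; exists C => z; exact: le_trans (gC z).
Qed.

Lemma quad_growthD f g : quad_growth f -> quad_growth g ->
  quad_growth (fun z => f z + g z).
Proof.
move=> [mf [C fC]] [mg [D gD]]; split; first exact: measurable_funD.
exists (C + D) => z; rewrite mulrDl (le_trans (ler_normD _ _))// lerD//.
Qed.

Lemma quad_growthZ (k : R) f : quad_growth f -> quad_growth (fun z => k * f z).
Proof.
move=> [mf [C fC]]; split; first exact: measurable_funM.
by exists (`|k| * C) => z; rewrite normrM -mulrA ler_wpM2l.
Qed.

Lemma quad_growthB f g : quad_growth f -> quad_growth g ->
  quad_growth (fun z => f z - g z).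
Proof.
move=> qf /(quad_growthZ (-1)) qg; have := quad_growthD qf qg.
by congr quad_growth; apply/funext => z; rewrite mulN1r.
Qed.

Lemma quad_growthM (K : R) f g : measurable_fun setT g -> (forall z, `|g z| <= K) ->
  quad_growth f -> quad_growth (fun z => f z * g z).
Proof.
move=> mg gK [mf [C fC]]; split; first exact: measurable_funM.
exists (C * K) => z; rewrite normrM mulrAC ler_pM//.
Qed.

Lemma quad_growth_sum (I : Type) (r : seq I) (F : I -> R[i] -> R) :
  (forall i, quad_growth (F i)) -> quad_growth (fun z => \sum_(i <- r) F i z).
Proof.
move=> qF; elim: r => [|i r IH].
  by under eq_fun do rewrite big_nil; exact: quad_growth_cst.
by under eq_fun do rewrite big_cons; exact: quad_growthD.
Qed.

Lemma quad_growth_abs2 : quad_growth (fun z => abs2 z).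
Proof.
split; first exact: measurable_abs2.
by exists 1 => z; rewrite mul1r ger0_norm ?abs2_ge0// lerDr.
Qed.

Lemma quad_growth_Re : quad_growth (fun z => complex.Re z).
Proof.
split; first exact: measurable_Re.
exists 1 => z; rewrite mul1r abs2E.
(* With [x] the real part, this square gives [2 |x| <= 1 + x^2]. *)
have := sqr_ge0 (`|complex.Re z| - 1); rewrite sqrrB mulr1 expr1n real_normK ?num_real//.
have := sqr_ge0 (complex.Im z); have := sqr_ge0 (complex.Re z); lra.
Qed.

Lemma quad_growth_Im : quad_growth (fun z => complex.Im z).
Proof.
split; first exact: measurable_Im.
exists 1 => z; rewrite mul1r abs2E.
have := sqr_ge0 (`|complex.Im z| - 1); rewrite sqrrB mulr1 expr1n real_normK ?num_real//.
have := sqr_ge0 (complex.Im z); have := sqr_ge0 (complex.Re z); lra.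
Qed.

Lemma abs2D_le z c : abs2 (z + c) <= 2 * abs2 z + 2 * abs2 c.
Proof.
rewrite !abs2E !raddfD/=.
have := sqr_ge0 (complex.Re z - complex.Re c).
have := sqr_ge0 (complex.Im z - complex.Im c).
by rewrite !sqrrB !sqrrD; lra.
Qed.

Lemma quad_growth_shift c f : quad_growth f -> quad_growth (fun z => f (z + c)).
Proof.
move=> [mf [C fC]]; split; first exact: measurableT_comp mf (measurable_addc c).
have C0 : 0 <= C.
  by have := le_trans (normr_ge0 _) (fC 0); rewrite pmulr_lge0// ltr_wpDr ?abs2_ge0.
(* With [u = abs2 z] and [v = abs2 c], [abs2D_le] leaves [1 + 2 u + 2 v <= (2 + 2 v) (1 + u)]. *)
exists (C * (2 + 2 * abs2 c)) => z; apply: le_trans (fC _) _.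
rewrite -mulrA ler_wpM2l//; have := abs2D_le z c.
have := mulr_ge0 (abs2_ge0 z) (abs2_ge0 c); have := abs2_ge0 z; have := abs2_ge0 c.
by move: (abs2 z) (abs2 c) (abs2 (z + c)) => u v w; lra.
Qed.

Lemma integrable_cgauss f : quad_growth f ->
  lam.-integrable setT (fun p => (f (cp p) * cgauss_pdf (cp p))%:E).
Proof.
move=> [mf [C fC]].
apply: (le_integrable _
  (g := fun p => (C%:E * ((1 + abs2 (cp p)) * cgauss_pdf (cp p))%:E)%E)) => //.
- apply/measurable_EFinP; apply: measurable_funM.
    exact: measurableT_comp mf (@measurable_complex_of_pair R).
  exact: measurableT_comp measurable_cgauss_pdf (@measurable_complex_of_pair R).
- move=> p _; rewrite -EFinM !abse_EFin lee_fin (mulrA C) normrM [X in _ <= X]normrM.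
  by apply: ler_wpM2r => //; rewrite (le_trans (fC _))// ler_norm.
- by apply: integrableZl => //; exact: integrable_cgauss_quad.
Qed.

Lemma integral_shift_pdf c f : measurable_fun setT f ->
  (\int[lam]_p (f (cp p) * cgauss_pdf (cp p - c))%:E =
   \int[lam]_p (f (cp p + c) * cgauss_pdf (cp p))%:E)%E.
Proof.
move=> mf.
rewrite -(integral_lebesgue2_shift c (f := fun z => (f z * cgauss_pdf (z - c))%:E)).
  by apply: eq_integral => p _; rewrite addrK.
apply/measurable_EFinP; apply: measurable_funM => //.
exact: measurableT_comp measurable_cgauss_pdf (measurable_addc (- c)).
Qed.

Lemma gauss_mean_shift c f : measurable_fun setT f ->
  gauss_mean c f = \int[lam]_p (f (cp p + c) * cgauss_pdf (cp p)).
Proof. by move=> mf; rewrite /gauss_mean /Rintegral integral_shift_pdf. Qed.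

(** Translating the integral of the absolute value brings the centre back to 0, where the growth
    bound of the translated function applies. *)
Lemma integrable_cgauss_shift c f : quad_growth f ->
  lam.-integrable setT (fun p => (f (cp p) * cgauss_pdf (cp p - c))%:E).
Proof.
move=> qf; have [mf _] := qf; apply/integrableP; split.
  apply/measurable_EFinP; apply: measurable_funM.
    exact: measurableT_comp mf (@measurable_complex_of_pair R).
  exact: measurableT_comp (measurableT_comp measurable_cgauss_pdf (measurable_addc (- c)))
    (@measurable_complex_of_pair R).
have /integrableP[_] := integrable_cgauss (quad_growth_shift c qf).
rewrite [X in (X < _)%E -> _](_ : _ =
  (\int[lam]_p (`|f (cp p + c)| * cgauss_pdf (cp p))%:E)%E); last first.
  by apply: eq_integral => p _; rewrite abse_EFin normrM (gtr0_norm (cgauss_pdf_gt0 _)).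
rewrite -(integral_shift_pdf c (f := fun z => `|f z|)); last exact: measurableT_comp.
by under eq_integral do rewrite -(gtr0_norm (cgauss_pdf_gt0 _)) -normrM -abse_EFin.
Qed.

Lemma gauss_mean_cst c (k : R) : gauss_mean c (fun=> k) = k.
Proof.
rewrite gauss_mean_shift// RintegralZl//; last first.
  by have := integrable_cgauss (quad_growth_cst 1); under eq_fun do rewrite mul1r.
by rewrite /Rintegral integral_cgauss_pdf mulr1.
Qed.

Lemma gauss_meanD c f g : quad_growth f -> quad_growth g ->
  gauss_mean c (fun z => f z + g z) = gauss_mean c f + gauss_mean c g.
Proof.
move=> qf qg; rewrite /gauss_mean -RintegralD//; [|exact: integrable_cgauss_shift..].
by apply: eq_Rintegral => p _; rewrite mulrDl.
Qed.

Lemma gauss_meanZ c (k : R) f : quad_growth f ->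
  gauss_mean c (fun z => k * f z) = k * gauss_mean c f.
Proof.
move=> qf; rewrite /gauss_mean -RintegralZl//; last exact: integrable_cgauss_shift.
by apply: eq_Rintegral => p _; rewrite mulrA.
Qed.

Lemma gauss_meanB c f g : quad_growth f -> quad_growth g ->
  gauss_mean c (fun z => f z - g z) = gauss_mean c f - gauss_mean c g.
Proof.
move=> qf qg; rewrite /gauss_mean -RintegralB//; [|exact: integrable_cgauss_shift..].
by apply: eq_Rintegral => p _; rewrite mulrBl.
Qed.

End gaussian_integrals.

(** * Posterior averages and the derivative of the log-evidence *)

Section posterior.
Variable R : realType.
Local Notation cp := (@complex_of_pair R).
Local Notation lam := (lebesgue2 R).
Implicit Types (r : seq R[i]) (s : R) (a c y z : R[i]) (f g : R[i] -> R).

(** The constant [pi^-1] and the uniform prior are left out, as they cancel in posterior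
    averages. *)
Definition likelihood s y a : R := expR (- abs2 (y - s%:C * a)).

Definition evidence r s y : R := \sum_(a <- r) likelihood s y a.

Definition posterior_avg r s g y : R :=
  (\sum_(a <- r) g a * likelihood s y a) / evidence r s y.

Lemma likelihood_gt0 s y a : 0 < likelihood s y a.
Proof. exact: expR_gt0. Qed.

Lemma cgauss_pdf_likelihood s y a :
  cgauss_pdf (y - s%:C * a) = pi^-1 * likelihood s y a.
Proof. by []. Qed.

Lemma sumr_gt0 (I : eqType) (r : seq I) (w : I -> R) :
  r != [::] -> (forall i, 0 < w i) -> 0 < \sum_(i <- r) w i.
Proof.
case: r => // i r _ w0; rewrite big_cons ltr_wpDr// sumr_ge0// => j _; exact: ltW.
Qed.

Lemma evidence_gt0 r s y : r != [::] -> 0 < evidence r s y.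
Proof. by move=> r0; apply: sumr_gt0 => // a; exact: likelihood_gt0. Qed.

(** Each normalised weight is at most 1. The resulting bound is free of the weights, hence uniform
    in the channel output. *)
Lemma weighted_avg_le (I : eqType) (r : seq I) (g w : I -> R) :
  r != [::] -> (forall i, 0 < w i) ->
  `|(\sum_(i <- r) g i * w i) / \sum_(i <- r) w i| <= \sum_(i <- r) `|g i|.
Proof.
move=> r0 w0; have W0 := sumr_gt0 r0 w0.
have w_le i : i \in r -> w i <= \sum_(j <- r) w j.
  by move=> ir; rewrite (big_rem i)//= lerDl sumr_ge0// => j _; exact: ltW.
rewrite normrM normfV (gtr0_norm W0) ler_pdivrMr//.
rewrite (le_trans (ler_norm_sum _ _ _))// mulr_suml [leLHS]big_seq [leRHS]big_seq ler_sum// => i ir.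
by rewrite normrM (gtr0_norm (w0 i)) ler_wpM2l// w_le.
Qed.

Lemma measurable_likelihood s a : measurable_fun setT (fun y => likelihood s y a).
Proof.
apply: measurableT_comp => //; apply: measurable_funN.
exact: measurableT_comp (@measurable_abs2 R) (measurable_addc _).
Qed.

Lemma measurable_sum_seq d (T : measurableType d) (I : Type) (r : seq I)
    (F : I -> T -> R) : (forall i, measurable_fun setT (F i)) ->
  measurable_fun setT (fun t => \sum_(i <- r) F i t).
Proof.
move=> mF; elim: r => [|i r IH].
  by under eq_fun do rewrite big_nil; exact: measurable_cst.
by under eq_fun do rewrite big_cons; exact: measurable_funD.
Qed.

Lemma measurable_evidence r s : measurable_fun setT (evidence r s).
Proof. by apply: measurable_sum_seq => a; exact: measurable_likelihood. Qed.

Lemma measurable_posterior_avg r s g : r != [::] ->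
  measurable_fun setT (posterior_avg r s g).
Proof.
move=> r0.
apply: measurable_funM.
  by apply: measurable_sum_seq => a; apply: measurable_funM => //; exact: measurable_likelihood.
(* Positivity of the evidence reduces measurability of the inverse to that of [expR] and [ln]. *)
have -> : (fun y => (evidence r s y)^-1) = (fun y => expR (- ln (evidence r s y))).
  by apply/funext => y; rewrite expRN lnK// posrE evidence_gt0.
apply: measurableT_comp => //; apply: measurable_funN.
exact: measurableT_comp (@measurable_ln R) (measurable_evidence r s).
Qed.

Lemma posterior_avg_le r s g y : r != [::] ->
  `|posterior_avg r s g y| <= \sum_(a <- r) `|g a|.
Proof. by move=> r0; apply: weighted_avg_le => // a; exact: likelihood_gt0. Qed.

Lemma quad_growth_posterior_avg r s g : r != [::] -> quad_growth (posterior_avg r s g).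
Proof.
move=> r0; apply: quad_growth_le (quad_growth_cst (\sum_(a <- r) `|g a|)) _.
  exact: measurable_posterior_avg.
by move=> y; rewrite (le_trans (posterior_avg_le _ _ _ r0))// ler_norm.
Qed.

Lemma quad_growth_mul_avg r s f g : r != [::] -> quad_growth f ->
  quad_growth (fun y => f y * posterior_avg r s g y).
Proof.
move=> r0; apply: quad_growthM; first exact: measurable_posterior_avg.
by move=> y; exact: posterior_avg_le.
Qed.

(** With all centres under one integral, the tower property becomes a pointwise identity of
    integrands. *)
Lemma sum_gauss_mean r (c : R[i] -> R[i]) (F : R[i] -> R[i] -> R) :
  (forall a, quad_growth (F a)) ->
  \sum_(a <- r) gauss_mean (c a) (F a) =
  \int[lam]_p (\sum_(a <- r) F a (cp p) * cgauss_pdf (cp p - c a)).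
Proof.
move=> qF; elim: r => [|a r IH].
  rewrite big_nil; under eq_Rintegral do rewrite big_nil.
  by rewrite Rintegral_cst// mul0r.
rewrite big_cons IH -RintegralD//; first last.
- rewrite (_ : _ \o _ = fun p =>
    (\sum_(b <- r) (F b (cp p) * cgauss_pdf (cp p - c b))%:E)%E); last first.
    by apply/funext => p /=; rewrite sumEFin.
  by apply: integrable_sum => // b _; exact: integrable_cgauss_shift.
- exact: integrable_cgauss_shift.
by apply: eq_Rintegral => p _; rewrite big_cons.
Qed.

(* The tower property E[g(A) f(Y)] = E[f(Y) E[g(A) | Y]]. *)
Lemma gauss_mean_tower r s f g : r != [::] -> quad_growth f ->
  \sum_(a <- r) g a * gauss_mean (s%:C * a) f =
  \sum_(a <- r) gauss_mean (s%:C * a) (fun y => f y * posterior_avg r s g y).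
Proof.
move=> r0 qf.
under eq_bigr do rewrite -gauss_meanZ//.
rewrite !sum_gauss_mean; first last.
- by move=> a; exact: quad_growth_mul_avg.
- by move=> a; exact: quad_growthZ.
apply: eq_Rintegral => p _; have E0 := evidence_gt0 s (cp p) r0.
under eq_bigr do rewrite cgauss_pdf_likelihood.
under [RHS]eq_bigr do rewrite cgauss_pdf_likelihood mulrA.
rewrite -mulr_sumr -/(evidence r s (cp p)) /posterior_avg.
have -> : f (cp p) * ((\sum_(a <- r) g a * likelihood s (cp p) a) / evidence r s (cp p)) *
   pi^-1 * evidence r s (cp p) =
   f (cp p) * pi^-1 * \sum_(a <- r) g a * likelihood s (cp p) a.
  by move: (gt_eqF E0) pi^-1 => /negbT e0 q; field.
by rewrite mulr_sumr; apply: eq_bigr => a _; ring.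
Qed.

(** Every likelihood is at most 1, so the logarithm is at most [ln (size r)]. Keeping only one point
    [b] of the list bounds it below by [- abs2 (y - s b)]. *)
Lemma quad_growth_ln_evidence r s : r != [::] ->
  quad_growth (fun y => ln (evidence r s y)).
Proof.
case: r => // b r _; split.
  exact: measurableT_comp (@measurable_ln R) (measurable_evidence _ _).
exists (2 + 2 * abs2 (- (s%:C * b)) + ln (size (b :: r))%:R) => y.
set S := evidence _ _ _; have S0 : 0 < S by exact: evidence_gt0.
have n1 : 1 <= (size (b :: r))%:R :> R by rewrite ler1n.
have up : ln S <= ln (size (b :: r))%:R.
  rewrite ler_ln ?posrE ?ltr0n// -sum1_size natr_sum ler_sum// => a _.
  by rewrite -[leRHS]expR0 ler_expR oppr_le0 abs2_ge0.
have lo : - abs2 (y - s%:C * b) <= ln S.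
  rewrite -[leLHS]expRK ler_ln ?posrE ?expR_gt0// /S /evidence big_cons lerDl.
  by rewrite sumr_ge0// => a _; exact/ltW/likelihood_gt0.
have l0 := ln_ge0 n1.
have := abs2D_le y (- (s%:C * b)); have := abs2_ge0 y; have := abs2_ge0 (- (s%:C * b)).
move: lo; move: (abs2 (y - s%:C * b)) (abs2 y) (abs2 (- (s%:C * b))) => u v w lo w0 v0 uvw.
have h1 : 0 <= w * v by exact: mulr_ge0.
have h2 : 0 <= ln (size (b :: r))%:R * v by exact: mulr_ge0.
rewrite ler_norml; move: l0 up h2; move: (ln (size (b :: r))%:R) => l l0 up h2.
by apply/andP; split; lra.
Qed.

End posterior.

(** * Differentiating the mean log-evidence in the amplitude *)

Section evidence_derivative.
Variable R : realType.
Local Notation cp := (@complex_of_pair R).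
Local Notation lam := (lebesgue2 R).
Implicit Types (r : seq R[i]) (s : R) (a c y z : R[i]).

Let dot c z : R := complex.Re c * complex.Re z + complex.Im c * complex.Im z.

Let dot_le c z : `|2 * dot c z| <= abs2 c + abs2 z.
Proof.
rewrite !abs2E /dot ler_norml.
have := sqr_ge0 (complex.Re c - complex.Re z); have := sqr_ge0 (complex.Im c - complex.Im z).
have := sqr_ge0 (complex.Re c + complex.Re z); have := sqr_ge0 (complex.Im c + complex.Im z).
by rewrite !sqrrB !sqrrD => *; apply/andP; split; lra.
Qed.

Lemma ReM_real s c : complex.Re (s%:C * c) = s * complex.Re c.
Proof. by case: c => x y /=; rewrite mul0r subr0. Qed.

Lemma ImM_real s c : complex.Im (s%:C * c) = s * complex.Im c.
Proof. by case: c => x y /=; rewrite mul0r addr0. Qed.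

Lemma measurable_channel_output d (T : measurableType d) s (V W : T -> R[i]) :
  measurable_fun setT V -> measurable_fun setT W ->
  measurable_fun setT (fun w => s%:C * V w + W w).
Proof.
move=> mV mW; have mRe := @measurable_Re R; have mIm := @measurable_Im R.
apply: measurable_fun_complex.
- under eq_fun do rewrite raddfD /= ReM_real.
  apply: measurable_funD; last exact: measurableT_comp mRe mW.
  by apply: measurable_funM => //; exact: measurableT_comp mRe mV.
- under eq_fun do rewrite raddfD /= ImM_real.
  apply: measurable_funD; last exact: measurableT_comp mIm mW.
  by apply: measurable_funM => //; exact: measurableT_comp mIm mV.
Qed.

Let abs2M_real s c : abs2 (s%:C * c) = s ^+ 2 * abs2 c.
Proof. by rewrite !abs2E ReM_real ImM_real !exprMn mulrDr. Qed.

Let is_derive_abs2 s c z :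
  is_derive s 1 (fun t : R => abs2 (t%:C * c + z)) (2 * dot c (s%:C * c + z)).
Proof.
rewrite (_ : (fun t => _) = fun t : R =>
    (t * complex.Re c + complex.Re z) ^+ 2 + (t * complex.Im c + complex.Im z) ^+ 2); last first.
  by apply/funext => t; rewrite abs2E !raddfD /= ReM_real ImM_real.
apply: is_derive_eq.
rewrite /dot !raddfD /= ReM_real ImM_real /GRing.scale/=; ring.
Qed.

(** At fixed noise [z] the residual is affine in [s] with slope [a - b], so its squared modulus has
    derivative [2 (a - b) . (y - s b)]. *)
Let residual s a b z : z + s%:C * a - s%:C * b = s%:C * (a - b) + z.
Proof. by rewrite mulrBr; ring. Qed.

Let is_derive_likelihood s a b z :
  is_derive s 1 (fun t : R => likelihood t (z + t%:C * a) b)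
    ((- 2 * dot (a - b) (z + s%:C * a - s%:C * b)) *
     likelihood s (z + s%:C * a) b).
Proof.
rewrite /likelihood.
under eq_fun do rewrite residual.
rewrite residual.
have d2 := is_derive_abs2 s (a - b) z.
have h := @is_derive1_comp R expR (fun t => - abs2 (t%:C * (a - b) + z)) s _ _
  (is_derive_expR _) (is_deriveN d2).
by apply: (is_derive_eq h); ring.
Qed.

Let is_derive_evidence r s a z :
  is_derive s 1 (fun t : R => evidence r t (z + t%:C * a))
    (\sum_(b <- r) (- 2 * dot (a - b) (z + s%:C * a - s%:C * b)) *
      likelihood s (z + s%:C * a) b).
Proof.
elim: r => [|b r IH].
  rewrite big_nil (_ : (fun _ => _) = cst 0); first exact: is_derive_cst.
  by apply/funext => t; rewrite /evidence big_nil.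
rewrite big_cons (_ : (fun _ => _) = (fun t : R => likelihood t (z + t%:C * a) b) \+
  (fun t : R => evidence r t (z + t%:C * a))); last first.
  by apply/funext => t; rewrite /evidence big_cons.
exact: is_deriveD.
Qed.

(** The derivative of the log-evidence when the noise is fixed and the output [y = z + s a] moves
    along with [s]. *)
Let score r s a y : R :=
  posterior_avg r s (fun b => - 2 * dot (a - b) (y - s%:C * b)) y.

Let is_derive_ln_evidence r s a z : r != [::] ->
  is_derive s 1 (fun t : R => ln (evidence r t (z + t%:C * a)))
    (score r s a (z + s%:C * a)).
Proof.
move=> r0; have E0 := evidence_gt0 s (z + s%:C * a) r0.
have h := is_derive1_comp (f := @ln R) (g := fun t => evidence r t (z + t%:C * a))
  (is_derive1_ln E0) (is_derive_evidence r s a z).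
by apply: (is_derive_eq h); rewrite mulrC.
Qed.

(** From [|2 u . v| <= |u|^2 + |v|^2] and [abs2D_le]. The bound increases with [|s|], as needed to
    dominate the derivative on an interval. *)
Let score_le r s a z : r != [::] ->
  `|score r s a (z + s%:C * a)| <=
  \sum_(b <- r) ((1 + 2 * s ^+ 2) * abs2 (a - b) + 2 * abs2 z).
Proof.
move=> r0; apply: le_trans (posterior_avg_le _ _ _ r0) _; apply: ler_sum => b _.
rewrite mulNr normrN residual; apply: le_trans (dot_le _ _) _.
have := abs2D_le (s%:C * (a - b)) z; rewrite abs2M_real.
by move: (abs2 (a - b)) (abs2 z) (abs2 _) => u v w; lra.
Qed.

Local Notation avg r s g y := (posterior_avg r s g y).
Local Notation Rec := (fun b => complex.Re b).
Local Notation Imc := (fun b => complex.Im b).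
Local Notation sq := (fun b => abs2 b).

(** Expanding [(a - b) . (y - s b)] and pulling [a] and [y] out of the average over [b] leaves only
    the posterior averages of the two components and of the squared modulus. *)
Let scoreE r s a y : r != [::] -> score r s a y =
  - 2 * (complex.Re a * complex.Re y + complex.Im a * complex.Im y
         - s * (complex.Re a * avg r s Rec y + complex.Im a * avg r s Imc y)
         - (complex.Re y * avg r s Rec y + complex.Im y * avg r s Imc y)
         + s * avg r s sq y).
Proof.
move=> r0; have := gt_eqF (evidence_gt0 s y r0); rewrite /score /posterior_avg.
set E := evidence r s y => /negbT E0.
have -> : \sum_(b <- r) (- 2 * dot (a - b) (y - s%:C * b)) * likelihood s y b =
  - 2 * ((complex.Re a * complex.Re y + complex.Im a * complex.Im y) * E
     - s * (complex.Re a * (\sum_(b <- r) complex.Re b * likelihood s y b)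
            + complex.Im a * (\sum_(b <- r) complex.Im b * likelihood s y b))
     - (complex.Re y * (\sum_(b <- r) complex.Re b * likelihood s y b)
        + complex.Im y * (\sum_(b <- r) complex.Im b * likelihood s y b))
     + s * \sum_(b <- r) abs2 b * likelihood s y b).
  rewrite {E0}/E /evidence; elim: r {r0} => [|b r IH]; first by rewrite !big_nil; ring.
  rewrite !big_cons IH /dot !raddfD !raddfN /= ReM_real ImM_real (abs2E b); ring.
by field.
Qed.

Let quad_growth_score r s a : r != [::] -> quad_growth (score r s a).
Proof.
move=> r0; rewrite (funext (fun y => scoreE s a y r0)).
have qR := @quad_growth_Re R; have qI := @quad_growth_Im R.
have qa g := quad_growth_posterior_avg s g r0.
have qm f g := @quad_growth_mul_avg R r s f g r0.
apply/quad_growthZ/quad_growthD; last exact: quad_growthZ.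
apply: quad_growthB; last by apply: quad_growthD; exact: qm.
by apply: quad_growthB; [|apply: quad_growthZ]; apply: quad_growthD; exact: quad_growthZ.
Qed.

(** After recentring at 0 the density no longer depends on [t], and dominated differentiation
    applies. *)
Let is_derive_gauss_mean_ln_evidence r s a : r != [::] ->
  is_derive s 1 (fun t : R => gauss_mean (t%:C * a) (fun y => ln (evidence r t y)))
    (gauss_mean (s%:C * a) (score r s a)).
Proof.
move=> r0; rewrite gauss_mean_shift; last by have [] := quad_growth_score s a r0.
have qL t := quad_growth_ln_evidence t r0.
rewrite (_ : (fun _ => _) = fun t : R =>
    \int[lam]_p (ln (evidence r t (cp p + t%:C * a)) * cgauss_pdf (cp p))); last first.
  by apply/funext => t; rewrite gauss_mean_shift//; have [] := qL t.
pose F (t : R) p := ln (evidence r t (cp p + t%:C * a)) * cgauss_pdf (cp p).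
(* Since [|t| <= |s| + 1] on []s - 1, s + 1[], [K] bounds the score for all such [t] at once. *)
pose K z : R := \sum_(b <- r) ((1 + 2 * (`|s| + 1) ^+ 2) * abs2 (a - b) + 2 * abs2 z).
have K0 z : 0 <= K z.
  apply: sumr_ge0 => b _; apply: addr_ge0; last by rewrite mulr_ge0// abs2_ge0.
  by rewrite mulr_ge0// ?abs2_ge0// addr_ge0// mulr_ge0// sqr_ge0.
pose G p := K (cp p) * cgauss_pdf (cp p).
have dF (t : R) p : is_derive t 1 (F ^~ p) (score r t a (cp p + t%:C * a) * cgauss_pdf (cp p)).
  have := is_derive_ln_evidence t a (cp p) r0 => dL.
  have h := is_deriveM dL (is_derive_cst (cgauss_pdf (cp p)) t 1).
  by apply: (is_derive_eq h); rewrite scaler0 add0r /GRing.scale/= mulrC.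
have Is : `]s - 1, s + 1[%classic s by rewrite /= in_itv/=; apply/andP; split; lra.
have iF (t : R) : `]s - 1, s + 1[%classic t -> lam.-integrable setT (EFin \o F t).
  by move=> _; exact: integrable_cgauss (quad_growth_shift _ (qL t)).
have derF (t : R) p : `]s - 1, s + 1[%classic t -> setT p -> derivable (F ^~ p) t 1.
  by move=> _ _; have [] := dF t p.
have G0 p : 0 <= G p by rewrite mulr_ge0// ltW// cgauss_pdf_gt0.
have iG : lam.-integrable setT (EFin \o G).
  apply: integrable_cgauss; apply: quad_growth_sum => b.
  by apply: quad_growthD; [exact: quad_growth_cst|exact/quad_growthZ/quad_growth_abs2].
have part (t : R) p : partial1of2 F t p = score r t a (cp p + t%:C * a) * cgauss_pdf (cp p).
  by rewrite partial1of2E; have [_ ->] := dF t p.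
have GF (t : R) p : `]s - 1, s + 1[%classic t -> setT p -> `|partial1of2 F t p| <= G p.
  rewrite /= in_itv/= => /andP[t1 t2] _.
  rewrite part /G normrM (gtr0_norm (cgauss_pdf_gt0 _)).
  apply: ler_wpM2r; first exact: ltW (cgauss_pdf_gt0 _).
  apply: (le_trans (score_le _ _ _ r0)); apply: ler_sum => b _.
  rewrite lerD2r ler_wpM2r ?abs2_ge0// lerD2l ler_wpM2l//.
  rewrite -(real_normK (num_real t)) lerXn2r ?nnegrE ?addr_ge0//.
  rewrite ler_norml; have := ler_norm s; have := ler_norm (- s); rewrite normrN => *.
  by apply/andP; split; lra.
split; first exact: (derivable_under_integral measurableT Is iF derF G0 iG GF).
rewrite -derive1E (differentiation_under_integral measurableT Is iF derF G0 iG GF).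
by apply: eq_Rintegral => p _; rewrite part.
Qed.


(* Summed over the inputs, the score is evaluated by the tower property alone:
   E[<A,Y>] cancels E[<E[A|Y],Y>], and the other terms are second moments. *)
Lemma is_derive_mean_ln_evidence r s : r != [::] ->
  is_derive s 1
    (fun t : R => \sum_(a <- r) gauss_mean (t%:C * a) (fun y => ln (evidence r t y)))
    (- 2 * s * (\sum_(a <- r) abs2 a - \sum_(a <- r) gauss_mean (s%:C * a)
       (fun y => avg r s Rec y ^+ 2 + avg r s Imc y ^+ 2))).
Proof.
move=> r0.
pose F a (t : R) : R := gauss_mean (t%:C * a) (fun y => ln (evidence r t y)).
(* The induction varies only the list of transmitted points; the list [r] inside the evidence stays
   fixed. *)
have dsum r' : is_derive s 1 (fun t : R => \sum_(a <- r') F a t)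
    (\sum_(a <- r') gauss_mean (s%:C * a) (score r s a)).
  elim: r' => [|a r' IH].
    have -> : (fun t : R => \sum_(a <- [::]) F a t) = cst 0.
      by apply/funext => t; rewrite big_nil.
    by rewrite big_nil; exact: is_derive_cst.
  have -> : (fun t : R => \sum_(b <- a :: r') F b t) =
      F a \+ (fun t : R => \sum_(b <- r') F b t).
    by apply/funext => t; rewrite big_cons.
  have d1 : is_derive s 1 (F a) _ := is_derive_gauss_mean_ln_evidence s a r0.
  by rewrite big_cons; exact: is_deriveD.
apply: (is_derive_eq (dsum r)).
have qR := @quad_growth_Re R; have qI := @quad_growth_Im R.
have qa g := quad_growth_posterior_avg s g r0.
have qm f g := @quad_growth_mul_avg R r s f g r0.
pose E a f := gauss_mean (s%:C * a) f.
have EscoreE a : E a (score r s a) =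
  - 2 * (complex.Re a * E a Rec + complex.Im a * E a Imc
         - s * (complex.Re a * E a (posterior_avg r s Rec)
                + complex.Im a * E a (posterior_avg r s Imc))
         - (E a (fun y => complex.Re y * avg r s Rec y)
            + E a (fun y => complex.Im y * avg r s Imc y))
         + s * E a (fun y => 1 * avg r s sq y)).
  rewrite /E (funext (fun y => scoreE s a y r0)).
  under [X in s * gauss_mean _ X]eq_fun do rewrite mul1r.
  have q1 := quad_growthD (quad_growthZ (complex.Re a) qR) (quad_growthZ (complex.Im a) qI).
  have q2 := quad_growthD (quad_growthZ (complex.Re a) (qa Rec))
    (quad_growthZ (complex.Im a) (qa Imc)).
  have q3 := quad_growthD (qm _ Rec qR) (qm _ Imc qI).
  have q12 := quad_growthB q1 (quad_growthZ s q2).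
  have q123 := quad_growthB q12 q3.
  rewrite gauss_meanZ; last exact: quad_growthD q123 (quad_growthZ s (qa sq)).
  rewrite gauss_meanD//; last exact: quad_growthZ.
  rewrite gauss_meanB// gauss_meanB//; last exact: quad_growthZ.
  rewrite gauss_meanD//; [|exact: quad_growthZ..].
  rewrite 2?gauss_meanZ// gauss_meanZ// gauss_meanD//; [|exact: quad_growthZ..].
  rewrite 2?gauss_meanZ// gauss_meanD ?gauss_meanZ//; exact: qm.
rewrite -/(E _ _); under eq_bigr do rewrite -/(E _ _) EscoreE.
have tower f g : quad_growth f ->
    \sum_(a <- r) g a * E a f = \sum_(a <- r) E a (fun y => f y * avg r s g y).
  exact: gauss_mean_tower.
have T1 := tower _ Rec qR; have T2 := tower _ Imc qI.
(* [T3] and [T4] turn the mean of [a . <a>] into that of [|<a>|^2]. [T5] takes the posterior average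
   of [|a|^2] back to the prior one, with the factor [1] of [EscoreE] as test function. *)
have T3 := tower _ Rec (qa Rec); have T4 := tower _ Imc (qa Imc).
have T5 := tower _ sq (quad_growth_cst 1).
rewrite -mulr_sumr !(big_split, sumrN)/= -!mulr_sumr !(big_split)/=.
rewrite T1 T2 T3 T4 -T5.
have -> : \sum_(a <- r) abs2 a * E a (fun=> 1) = \sum_(a <- r) abs2 a.
  by apply: eq_bigr => a _; rewrite /E gauss_mean_cst mulr1.
have -> : \sum_(a <- r) gauss_mean (s%:C * a) (fun y => avg r s Rec y ^+ 2 + avg r s Imc y ^+ 2) =
  \sum_(a <- r) E a (fun y => avg r s Rec y * avg r s Rec y) +
  \sum_(a <- r) E a (fun y => avg r s Imc y * avg r s Imc y).
  rewrite -big_split/=; apply: eq_bigr => a _.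
  by rewrite /E -gauss_meanD//; exact: qm.
ring.
Qed.

End evidence_derivative.

(** * Functionals of Gaussian noise *)

Section density_transfer.
Local Open Scope ereal_scope.
Context d1 d2 d3 (T : measurableType d1) (X : measurableType d2)
  (Y : measurableType d3) (R : realType).
Variables (P : {measure set T -> \bar R}) (mu : {measure set X -> \bar R}).
Variables (D : set T) (Z : T -> Y) (phi : X -> Y) (g : X -> R).
Hypotheses (mD : measurable D) (mZ : measurable_fun setT Z)
  (mphi : measurable_fun setT phi) (mg : measurable_fun setT g)
  (g0 : forall x, (0 <= g x)%R).
Hypothesis lawZ : forall B, measurable B ->
  P (Z @^-1` B `&` D) = \int[mu]_(x in phi @^-1` B) (g x)%:E.

Import HBNNSimple.

Let mpreZ B : measurable B -> measurable (Z @^-1` B).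
Proof. by move=> mB; rewrite -[X in measurable X]setTI; exact: mZ. Qed.

(** The alternative [B = set0] serves negative [r], whose preimage under a nonnegative simple
    function is empty. *)
Let integral_density_indic r (B : set Y) : measurable B ->
  (0 <= r)%R \/ B = set0 ->
  \int[P]_(w in D) (r * \1_B (Z w))%:E =
  \int[mu]_x ((r * \1_B (phi x))%:E * (g x)%:E).
Proof.
move=> mB [r0|->]; last first.
  by rewrite !integral0_eq// => x _; rewrite indic0 mulr0 ?mul0e.
have mI : measurable_fun setT (\1_B : Y -> R) by exact: measurable_indic.
under eq_integral do rewrite EFinM.
rewrite ge0_integralZl_EFin//; last first.
  by apply/measurable_EFinP; apply: measurable_funTS; exact: measurableT_comp mI mZ.
have -> : \int[P]_(w in D) (\1_B (Z w))%:E = P (Z @^-1` B `&` D).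
  by rewrite -(integral_indic _ mD) //; exact: mpreZ.
under [RHS]eq_integral do rewrite EFinM -muleA.
rewrite ge0_integralZl_EFin//; last 2 first.
- by move=> x _; rewrite -EFinM lee_fin mulr_ge0.
- apply: emeasurable_funM; apply/measurable_EFinP => //.
  exact: measurableT_comp mI mphi.
congr (_ * _); rewrite lawZ// integral_mkcond; apply: eq_integral => x _.
rewrite patchE indicE /=; case: ifPn => [|]; rewrite ?inE ?notin_setE /= => Bx.
  by rewrite mem_set// mul1e.
by rewrite memNset// mul0e.
Qed.

Let integral_density_nnsfun (h : {nnsfun Y >-> R}) :
  \int[P]_(w in D) (h (Z w))%:E = \int[mu]_x ((h (phi x))%:E * (g x)%:E).
Proof.
have mI r : measurable_fun setT (fun y => r * \1_(h @^-1` [set r]) y)%R.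
  by apply: measurable_funM.
transitivity (\int[P]_(w in D)
    (\sum_(r \in range h) (r * \1_(h @^-1` [set r]) (Z w))%:E)).
  by apply: eq_integral => w _; rewrite fimfunE -fsumEFin.
rewrite ge0_integral_fsum//; last 2 first.
- move=> r; apply/measurable_EFinP/measurable_funTS.
  exact: measurableT_comp (mI r) mZ.
- by move=> r w _; exact: nnfun_muleindic_ge0.
transitivity (\int[mu]_x
    (\sum_(r \in range h) ((r * \1_(h @^-1` [set r]) (phi x))%:E * (g x)%:E))).
  rewrite ge0_integral_fsum//; last 2 first.
  - move=> r; apply: emeasurable_funM; apply/measurable_EFinP => //.
    exact: measurableT_comp (mI r) mphi.
  - by move=> r x _; apply: mule_ge0; [exact: nnfun_muleindic_ge0|rewrite lee_fin].
  apply: eq_fsbigr => r _; apply: integral_density_indic => //.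
  by have [?|r0] := leP 0%R r; [left|right; exact: preimage_nnfun0].
apply: eq_integral => x _; rewrite [in RHS]fimfunE -fsumEFin// ge0_mule_fsuml//.
by move=> r; exact: nnfun_muleindic_ge0.
Qed.

(** [lawZ] says that the law of [Z] restricted to [D] is the image under [phi] of the measure with
    density [g]. The equality passes from indicators to simple functions and then to monotone
    limits. *)
Lemma ge0_integral_density (f : Y -> \bar R) :
  measurable_fun setT f -> (forall y, 0 <= f y) ->
  \int[P]_(w in D) f (Z w) = \int[mu]_x (f (phi x) * (g x)%:E).
Proof.
move=> mf f0; pose h := nnsfun_approx measurableT mf.
have cvgh y : EFin \o h ^~ y @ \oo --> f y by exact: cvg_nnsfun_approx.
transitivity (limn (fun n => \int[P]_(w in D) (h n (Z w))%:E)).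
  rewrite -monotone_convergence//.
  - by apply: eq_integral => w _; apply/esym/cvg_lim => //; exact: cvgh.
  - move=> n; apply/measurable_EFinP/measurable_funTS.
    exact: measurableT_comp (@measurable_funP _ _ _ _ _ (h n)) mZ.
  - by move=> n w _; rewrite lee_fin.
  - by move=> w _ a b ab; rewrite lee_fin; exact/lefP/nd_nnsfun_approx.
under eq_fun do rewrite integral_density_nnsfun.
rewrite -monotone_convergence//.
- apply: eq_integral => x _; apply/cvg_lim => //.
  by apply: cvgeZr => //; exact: cvgh.
- move=> n; apply: emeasurable_funM; apply/measurable_EFinP => //.
  exact: measurableT_comp (@measurable_funP _ _ _ _ _ (h n)) mphi.
- by move=> n x _; rewrite mule_ge0 ?lee_fin.
- move=> x _ a b ab; rewrite lee_wpmul2r ?lee_fin//.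
  exact/lefP/nd_nnsfun_approx.
Qed.

End density_transfer.

(** * Expectations under a finite mixture of events independent of the noise *)

Section gaussian_noise.
Context d (T : measurableType d) (R : realType) (P : probability T R).
Local Notation cp := (@complex_of_pair R).
Local Notation lam := (lebesgue2 R).
Variable Z : T -> R[i].
Hypotheses (mZ : measurable_fun setT Z) (gaussZ : cgaussian P Z).

(** Inputs are finite-valued, so independence enters through the events that fix the input. *)
Definition event_indep (E : set T) := forall D : set R[i], measurable D ->
  P (E `&` Z @^-1` D) = (P E * P (Z @^-1` D))%E.

(** By independence the noise restricted to [E] has density [k * cgauss_pdf]. *)
Let integral_event_ge0 (E : set T) (k : R) (h : R[i] -> R) :
  measurable E -> P E = k%:E -> event_indep E -> quad_growth h ->
  (forall z, 0 <= h z) ->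
  P.-integrable E (fun w => (h (Z w))%:E) /\
  (\int[P]_(w in E) (h (Z w))%:E = (k * gauss_mean 0 h)%:E)%E.
Proof.
move=> mE PE indE qh h0; have [mh _] := qh.
have k0 : 0 <= k by rewrite -lee_fin -PE.
have mpdf : measurable_fun setT (fun p => cgauss_pdf (cp p)).
  exact: measurableT_comp (@measurable_cgauss_pdf R) (@measurable_complex_of_pair R).
have pdf0 z : 0 <= cgauss_pdf z :> R by exact: ltW (cgauss_pdf_gt0 z).
have mhE : measurable_fun setT (fun z => (h z)%:E) by exact/measurable_EFinP.
have ih : lam.-integrable setT (EFin \o (fun p => h (cp p) * cgauss_pdf (cp p))).
  exact: integrable_cgauss.
have EhZ : (\int[P]_(w in E) (h (Z w))%:E = (k * gauss_mean 0 h)%:E)%E.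
  rewrite (@ge0_integral_density _ _ _ _ _ _ _ P lam E Z cp
    (fun p => k * cgauss_pdf (cp p)) mE mZ (@measurable_complex_of_pair R) _ _ _
    (fun z => (h z)%:E))//.
  - transitivity (\int[lam]_p (k%:E * (h (cp p) * cgauss_pdf (cp p))%:E))%E.
      by apply: eq_integral => p _; rewrite -!EFinM mulrCA.
    rewrite integralZl// EFinM; congr (_ * _)%E.
    rewrite /gauss_mean /Rintegral fineK; last first.
      by under eq_integral do rewrite subr0; exact: integrable_fin_num.
    by apply: eq_integral => p _; rewrite subr0.
  - exact: measurable_funM.
  - by move=> p; exact: mulr_ge0.
  - move=> B mB; rewrite setIC.
    transitivity (P E * P (Z @^-1` B))%E; first exact: indE.
    rewrite PE gaussZ//.
    have mcB : measurable (cp @^-1` B).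
      by rewrite -[X in measurable X]setTI; exact: measurable_complex_of_pair.
    rewrite -ge0_integralZl_EFin//; last first.
      by apply/measurable_EFinP/measurable_funTS.
    by move=> p _; rewrite lee_fin.
split => //; apply/integrableP; split.
  exact/measurable_EFinP/measurable_funTS/(measurableT_comp mh mZ).
under eq_integral do rewrite abse_EFin ger0_norm//.
by rewrite EhZ ltry.
Qed.

(** A signed [h] is the difference of the nonnegative functions [h + K] and [K], where [K] is its
    quadratic majorant. *)
Let integral_event (E : set T) (k : R) (h : R[i] -> R) :
  measurable E -> P E = k%:E -> event_indep E -> quad_growth h ->
  P.-integrable E (fun w => (h (Z w))%:E) /\
  (\int[P]_(w in E) (h (Z w))%:E = (k * gauss_mean 0 h)%:E)%E.
Proof.
move=> mE PE indE qh; have [_ [C hC]] := qh.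
pose K (z : R[i]) := C * (1 + abs2 z).
have qK : quad_growth K.
  by apply: quad_growthZ; apply: quad_growthD; [exact: quad_growth_cst|exact: quad_growth_abs2].
have qhK := quad_growthD qh qK.
have K0 z : 0 <= K z := le_trans (normr_ge0 _) (hC z).
have hK0 z : 0 <= h z + K z.
  by rewrite -lerBlDr sub0r; have := hC z; rewrite ler_norml => /andP[].
have [i1 e1] := integral_event_ge0 mE PE indE qhK hK0.
have [i2 e2] := integral_event_ge0 mE PE indE qK K0.
have hE : (fun w => (h (Z w))%:E) =
    ((fun w => (h (Z w) + K (Z w))%:E) \- (fun w => (K (Z w))%:E))%E.
  by apply/funext => w; rewrite /= -EFinB addrK.
rewrite hE; split; first exact: integrableB.
by rewrite integralB// e1 e2 -EFinB -mulrBr gauss_meanD// addrK.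
Qed.

(** The disjoint events have total probability 1, so their complement is negligible and the integral
    splits over them. On each event [g] is a function of the noise alone. *)
Lemma integral_gaussian_mixture (I : eqType) (r : seq I) (E : I -> set T)
    (c : I -> R) (h : I -> R[i] -> R) (g : T -> R) :
  uniq r -> (forall i, measurable (E i)) -> trivIset [set` r] E ->
  (forall i, i \in r -> P (E i) = (c i)%:E) -> \sum_(i <- r) c i = 1 ->
  (forall i, i \in r -> event_indep (E i)) ->
  (forall i, i \in r -> quad_growth (h i)) ->
  measurable_fun setT g ->
  (forall i w, i \in r -> E i w -> g w = h i (Z w)) ->
  P.-integrable setT (fun w => (g w)%:E) /\
  (\int[P]_w (g w)%:E = (\sum_(i <- r) c i * gauss_mean 0 (h i))%:E)%E.
Proof.
move=> ur mE tE PE c1 indE qh mg gE.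
pose U := \big[setU/set0]_(i <- r) E i.
have mU : measurable U by exact: bigsetU_measurable.
have PU : P U = 1%E.
  have := @integral_bigsetU_EFin _ _ _ P _ E (cst 1) r mE ur tE.
  rewrite /= -/U integral_cst// mul1e => ->; last by apply/measurable_EFinP; exact: measurable_cst.
  under eq_bigr do rewrite integral_cst// mul1e.
  rewrite -c1 -sumEFin big_seq [RHS]big_seq; apply: eq_bigr => i; exact: PE.
have PCU : P (~` U) = 0%E by rewrite probability_setC// PU subee.
have mgE : measurable_fun setT (fun w => (g w)%:E) by exact/measurable_EFinP.
have setTCU : [set: T] `\` ~` U = U by rewrite setTD setCK.
have mCU : measurable (~` U) by exact: measurableC.
have ev i : i \in r -> P.-integrable (E i) (fun w => (g w)%:E) /\
    (\int[P]_(w in E i) (g w)%:E = (c i * gauss_mean 0 (h i))%:E)%E.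
  move=> ir; have [i1 e1] := integral_event (mE i) (PE _ ir) (indE _ ir) (qh _ ir).
  split; last by rewrite -e1; apply: eq_integral => w; rewrite inE => /(gE _ _ ir) ->.
  by apply: eq_integrable i1 => // w; rewrite inE => /(gE _ _ ir) ->.
have ig : P.-integrable setT (fun w => (g w)%:E).
  apply/integrableP; split => //.
  rewrite (ge0_negligible_integral mCU)//; last exact: measurableT_comp.
  rewrite setTCU ge0_integral_bigsetU//; last first.
    by apply: measurable_funTS; exact: measurableT_comp.
  rewrite big_seq; apply: lte_sum_pinfty => i ir.
  by have [/integrableP[]] := ev i ir.
split => //; rewrite (negligible_integral mCU)// setTCU.
rewrite integral_bigsetU_EFin//; last exact: measurable_funTS.
rewrite -sumEFin big_seq [RHS]big_seq; apply: eq_bigr => i ir.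
by have [_ ->] := ev i ir.
Qed.

End gaussian_noise.

(** * The mutual information terms *)

Section posterior_mean.
Variable R : realType.
Implicit Types (A : {fset R[i]}) (s snr : R) (a b z : R[i]).
Local Notation Rec := (fun b => complex.Re b).
Local Notation Imc := (fun b => complex.Im b).

(** The weight depends on the sent point [a] and the noise [z] only through the output
    [y = z + s a]. *)
Lemma channel_weightE snr a z b :
  channel_weight snr a z b = likelihood (Num.sqrt snr) (z + (Num.sqrt snr)%:C * a) b.
Proof.
rewrite /channel_weight /likelihood; congr (expR (- abs2 _)).
by rewrite mulrBr; ring.
Qed.

(** The denominator is real, so the quotient can be taken in each component. *)
Lemma posterior_meanE A snr a z :
  posterior_mean A snr a z =
  posterior_avg A (Num.sqrt snr) Rec (z + (Num.sqrt snr)%:C * a) +i*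
  posterior_avg A (Num.sqrt snr) Imc (z + (Num.sqrt snr)%:C * a).
Proof.
rewrite /posterior_mean /posterior_avg /evidence.
under eq_bigr do rewrite channel_weightE.
under [X in _ / X%:C]eq_bigr do rewrite channel_weightE.
set y := _ + _; set W := \sum_(a' <- A) likelihood _ y a'.
rewrite -(fmorphV (real_complex R) W).
have ReMr (x : R[i]) k : complex.Re (x * k%:C) = complex.Re x * k.
  by case: x => u v /=; rewrite mulr0 subr0.
have ImMr (x : R[i]) k : complex.Im (x * k%:C) = complex.Im x * k.
  by case: x => u v /=; rewrite mulr0 add0r.
apply/eqP; rewrite eq_complex/= ReMr ImMr; apply/andP; split; apply/eqP;
  congr (_ * _).
- rewrite raddf_sum; apply: eq_bigr => a' _; exact: ReMr.
- rewrite raddf_sum; apply: eq_bigr => a' _; exact: ImMr.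
Qed.

Lemma sum1_fset A : \sum_(x <- A) 1 = #|` A|%:R :> R.
Proof. by rewrite -sum1_size natr_sum. Qed.

(** This is [#|A|] times the second moment of the conditional mean of the input given the output. *)
Definition posterior_energy A s : R :=
  \sum_(a <- A) gauss_mean (s%:C * a)
    (fun y => posterior_avg A s Rec y ^+ 2 + posterior_avg A s Imc y ^+ 2).

Lemma mmseE A snr : A != fset0 -> mmse A snr =
  (#|` A|%:R)^-1 * (\sum_(a <- A) abs2 a - posterior_energy A (Num.sqrt snr)).
Proof.
move=> A0; rewrite /mmse mulrBr; congr (_ - _ * _); apply: eq_bigr => a _.
rewrite gauss_mean_shift; last first.
  have A0' : (A : seq R[i]) != [::] by rewrite -size_eq0 cardfs_eq0.
  by apply: measurable_funD; apply: measurable_funX; exact: measurable_posterior_avg.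
apply: eq_Rintegral => p _; rewrite abs2E posterior_meanE /= /cgauss_pdf.
by ring.
Qed.

(** The mutual information of input and output is [ln #|A| - 1] minus this quantity, whence the sign
    of the derivative below. *)
Definition mean_ln_evidence (A : {fset R[i]}) (s : R) : R := (#|` A|%:R)^-1 *
  \sum_(a <- A) gauss_mean (s%:C * a) (fun y => ln (evidence A s y)).

Lemma is_derive_mean_ln_evidence_snr (A : {fset R[i]}) (snr : R) :
  A != fset0 -> 0 < snr ->
  is_derive snr 1 (fun t => mean_ln_evidence A (Num.sqrt t)) (- mmse A snr).
Proof.
move=> A0 snr0; have A0' : (A : seq R[i]) != [::] by rewrite -size_eq0 cardfs_eq0.
have h1 := is_derive_mean_ln_evidence (Num.sqrt snr) A0'.
have h2 := is_deriveZ (#|` A|%:R)^-1 h1.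
have h := is_derive1_comp (f := mean_ln_evidence A) h2 (is_derive1_sqrt snr0).
apply: (is_derive_eq h); rewrite mmseE// /posterior_energy /GRing.scale/=.
have : Num.sqrt snr != 0 by rewrite gt_eqF// sqrtr_gt0.
set c := (_)^-1; set D := _ - _; move: c D => c D s0.
by field.
Qed.

End posterior_mean.

(** * One bit position: the two halves of the constellation *)

Section bicm_terms.
Variables (R : realType) (m : nat) (X : {fset R[i]}) (label : X -> m.-tuple bool).
Hypotheses (hX : #|` X| = (2 ^ m)%N) (hlabel : bijective label).
Variable i : 'I_m.

Let bit (x : X) : bool := tnth (label x) i.
Let sub b := subconstellation label i b.

Let in_sub x b : (val x \in sub b) = (bit x == b).
Proof.
apply/imfsetP/idP => [[y /= yb /val_inj ->] //|xb].
by exists x.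
Qed.

Let sum_sub b (F : R[i] -> R) :
  \sum_(x <- sub b) F x = \sum_(x : X | bit x == b) F (val x).
Proof.
rewrite (perm_big [seq val x | x <- enum {: X} & bit x == b]) /=.
  by rewrite big_map big_filter big_enum_cond.
apply: uniq_perm; first exact: fset_uniq.
  by rewrite (map_inj_uniq val_inj) filter_uniq// enum_uniq.
move=> z; apply/idP/mapP => [/imfsetP[x /= xb ->]|[x]].
  by exists x => //; rewrite mem_filter mem_enum andbT.
by rewrite mem_filter => /andP[xb _] ->; rewrite in_sub.
Qed.

Let sum_X (F : R[i] -> R) :
  \sum_(x <- X) F x = \sum_(b : bool) \sum_(x <- sub b) F x.
Proof.
rewrite big_seq_fsetE /= (partition_big bit predT)//=.
by apply: eq_bigr => b _; rewrite sum_sub.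
Qed.

Let flip (t : m.-tuple bool) : m.-tuple bool :=
  [tuple (if j == i then ~~ tnth t j else tnth t j) | j < m].

Let flipK : involutive flip.
Proof.
move=> t; apply: eq_from_tnth => j; rewrite !tnth_mktuple.
by case: eqP => // _; rewrite negbK.
Qed.

(** Since the labelling is bijective, complementing bit [i] of the label permutes the constellation
    and exchanges the two halves. *)
Let card_sub_flip : #|` sub true| = #|` sub false|.
Proof.
have [g lK gK] := hlabel.
have E b : #|` sub b|%:R = \sum_(x : X | bit x == b) 1 :> R.
  by rewrite -(sum_sub b (fun=> 1)) sum1_fset.
apply/eqP; rewrite -(eqr_nat R) !E; apply/eqP.
rewrite (reindex_inj (h := fun x => g (flip (label x)))) /=; last first.
  by apply: can_inj (fun x => g (flip (label x))) _ => x; rewrite gK flipK lK.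
apply: eq_bigl => x; rewrite /bit gK tnth_mktuple eqxx.
by case: (tnth _ _).
Qed.

(** A fair bit followed by a uniform point of its half gives a uniform point of [X]. *)
Let inv_card_sub b : 2^-1 * (#|` sub b|%:R)^-1 = (#|` X|%:R)^-1 :> R.
Proof.
have E : #|` X|%:R = 2 * #|` sub b|%:R :> R.
  have := sum_X (fun=> 1); rewrite big_bool/= !sum1_fset.
  by move=> ->; case: b; rewrite card_sub_flip mulr_natl mulr2n.
by rewrite E invfM.
Qed.

Let X0 : (X : seq R[i]) != [::].
Proof. by rewrite -size_eq0 hX -lt0n expn_gt0. Qed.

Let sub_neq0 b : sub b != fset0.
Proof.
rewrite -cardfs_eq0 -(eqr_nat R); apply: contraTneq isT => E.
(* As [0^-1 = 0], an empty half would give [#|X|^-1 = 0]. *)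
have := inv_card_sub b; rewrite E invr0 mulr0 => /esym/eqP.
by rewrite invr_eq0 pnatr_eq0 hX expn_eq0.
Qed.

Let sub0 b : (sub b : seq R[i]) != [::].
Proof. by rewrite -size_eq0 cardfs_eq0 sub_neq0. Qed.

(** The logarithm of the quotient is a difference of two log-evidences plus [ln 2], averaged over
    the events that fix the input. *)
Lemma bicm_termE d (T : measurableType d) (P : probability T R)
    (B : {RV P >-> bool}) (S Z : {RV P >-> R[i]}) (snr : R) :
  bicm_inputs label P i B S Z ->
  bicm_term label P i B S Z snr =
  2^-1 * (\sum_(b : bool) mean_ln_evidence (sub b) (Num.sqrt snr))
  - mean_ln_evidence X (Num.sqrt snr) + ln 2.
Proof.
move=> [PB PBS gZ indZ]; set s := Num.sqrt snr.
pose L (A : {fset R[i]}) y : R := ln (evidence A s y).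
(* A point determines its bit, so the events are indexed by points alone; each has probability
   [#|X|^-1]. *)
pose E (x : X) : set T := B @^-1` [set bit x] `&` S @^-1` [set val x].
pose h (x : X) z : R := L (sub (bit x)) (z + s%:C * val x) - L X (z + s%:C * val x) + ln 2.
pose g w : R := (if B w then L (sub true) (Z w + s%:C * S w)
   else L (sub false) (Z w + s%:C * S w)) - L X (Z w + s%:C * S w) + ln 2.
have lnE w : ln ((\sum_(x' <- subconstellation label i (B w)) channel_weight snr (S w) (Z w) x') /
        (2^-1 * \sum_(x' <- X) channel_weight snr (S w) (Z w) x')) = g w.
  have ev (r : seq R[i]) : \sum_(x' <- r) channel_weight snr (S w) (Z w) x' =
      evidence r s (Z w + s%:C * S w).
    by apply: eq_bigr => x' _; rewrite channel_weightE.
  rewrite !ev /g; set y := _ + _.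
  have ln_ratio b : ln (evidence (sub b) s y / (2^-1 * evidence X s y)) =
      L (sub b) y - L X y + ln 2.
    have e1 := evidence_gt0 s y (sub0 b); have e2 := evidence_gt0 s y X0.
    rewrite ln_div ?posrE ?mulr_gt0 ?invr_gt0// lnM ?posrE ?invr_gt0// lnV ?posrE//.
    by rewrite opprD opprK addrA addrAC.
  by case: (B w); exact: ln_ratio.
have mB : measurable_fun setT B by exact: measurable_funP.
have mS : measurable_fun setT S by exact: measurable_funP.
have mZ : measurable_fun setT Z by exact: measurable_funP.
have mY : measurable_fun setT (fun w => Z w + s%:C * S w).
  by under eq_fun do rewrite addrC; exact: measurable_channel_output.
have mL (A : {fset R[i]}) : (A : seq R[i]) != [::] ->
    measurable_fun setT (fun w => L A (Z w + s%:C * S w)).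
  by move=> A0; apply: measurableT_comp mY; have [] := quad_growth_ln_evidence s A0.
have mg : measurable_fun setT g.
  apply: measurable_funD => //; apply: measurable_funB; last exact: mL.
  by apply: measurable_fun_ifT => //; exact: mL.
have msing := @measurable_set1_complex R.
have mE x : measurable (E x).
  apply: measurableI; rewrite -[X in measurable X]setTI.
    exact: mB.
  exact: mS.
have qL (A : {fset R[i]}) : (A : seq R[i]) != [::] -> quad_growth (L A).
  exact: quad_growth_ln_evidence.
have qh x : quad_growth (h x).
  apply: quad_growthD; last exact: quad_growth_cst.
  by apply: quad_growthB; apply: quad_growth_shift; exact: qL.
have [] := @integral_gaussian_mixture _ _ _ P Z mZ gZ X (index_enum X) E
  (fun=> (#|` X|%:R)^-1) h g.
- exact: index_enum_uniq.
- exact: mE.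
- move=> x y _ _ [w [[_ Sx] [_ Sy]]]; apply: val_inj; rewrite /= in Sx Sy.
  exact: etrans (esym Sx) Sy.
- move=> x _; rewrite /E PBS ?in_sub// PB -EFinM inv_card_sub//.
- rewrite sumr_const -cardfE -[LHS]mulr_natr mulVf// pnatr_eq0 hX expn_eq0//.
- move=> x _ D mD; have mE1 : measurable ([set bit x] `*` [set val x]) by exact: measurableX.
  exact: indZ mE1 mD.
- by move=> x _; exact: qh.
- exact: mg.
- by move=> x w _ [/= Bx Sx]; rewrite /g /h Bx Sx; case: (bit x).
move=> _ Eg; rewrite /bicm_term unlock (_ : (fun w => _) = (fun w => (g w)%:E)); last first.
  by apply/funext => w /=; rewrite lnE.
rewrite Eg /= {Eg}.
have hE x : gauss_mean 0 (h x) =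
    gauss_mean (s%:C * val x) (L (sub (bit x))) - gauss_mean (s%:C * val x) (L X) + ln 2.
  have q1 := quad_growth_shift (s%:C * val x) (qL _ (sub0 (bit x))).
  have q2 := quad_growth_shift (s%:C * val x) (qL _ X0).
  rewrite gauss_meanD; [|exact: quad_growthB|exact: quad_growth_cst].
  rewrite (gauss_meanB 0 q1 q2) gauss_mean_cst.
  have shift (A : {fset R[i]}) (A0 : (A : seq R[i]) != [::]) :
      gauss_mean 0 (fun z => L A (z + s%:C * val x)) = gauss_mean (s%:C * val x) (L A).
    rewrite [RHS]gauss_mean_shift; last by have [] := qL A A0.
    by apply: eq_Rintegral => p _; rewrite subr0.
  by rewrite (shift _ (sub0 (bit x))) (shift _ X0).
rewrite -mulr_sumr (eq_bigr _ (fun x _ => hE x)).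
rewrite !big_split/= sumrN !mulrDr; congr (_ + _ + _).
(* Points are grouped by bit, and [#|X|^-1] splits as [2^-1 * #|sub b|^-1]. *)
- rewrite (partition_big bit predT)//= !mulr_sumr; apply: eq_bigr => b _.
  rewrite /mean_ln_evidence mulrA inv_card_sub sum_sub; congr (_ * _).
  by apply: eq_bigr => x /eqP ->.
- by rewrite mulrN /mean_ln_evidence big_seq_fsetE.
- rewrite sumr_const -cardfE -(mulr_natr (ln 2)) mulrCA mulVf ?mulr1// pnatr_eq0 hX expn_eq0//.
Qed.

Lemma is_derive_bicm_term d (T : measurableType d) (P : probability T R)
    (B : {RV P >-> bool}) (S Z : {RV P >-> R[i]}) (snr : R) :
  bicm_inputs label P i B S Z -> 0 < snr ->
  is_derive snr 1 (bicm_term label P i B S Z)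
    (2^-1 * \sum_(b : bool) (mmse X snr - mmse (sub b) snr)).
Proof.
move=> BSZ snr0.
have fX0 : X != fset0 by rewrite -cardfs_eq0 hX expn_eq0.
pose I (A : {fset R[i]}) (t : R) : R := mean_ln_evidence A (Num.sqrt t).
have dI (A : {fset R[i]}) : A != fset0 -> is_derive snr 1 (I A) (- mmse A snr).
  by move=> A0; exact: is_derive_mean_ln_evidence_snr.
rewrite (_ : bicm_term _ _ _ _ _ _ =
  (2^-1 \*: (I (sub true) + I (sub false)) - I X) + cst (ln 2)); last first.
  by apply/funext => t; rewrite bicm_termE// big_bool.
have h := is_deriveD (is_deriveB (is_deriveZ 2^-1
  (is_deriveD (dI _ (sub_neq0 true)) (dI _ (sub_neq0 false)))) (dI _ fX0))
  (is_derive_cst (ln 2) snr 1).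
apply: (is_derive_eq h); rewrite big_bool /GRing.scale/=.
by move: (mmse _ _) (mmse _ _) (mmse _ _) => u v w; field.
Qed.

End bicm_terms.

(** * The estimation error of the posterior mean *)

Section conditional_mean.
Context d (T : measurableType d) (R : realType) (Q : probability T R).
Local Notation Rec := (fun b => complex.Re b).
Local Notation Imc := (fun b => complex.Im b).

(** The difference has constant sign on [G] and on its complement, so the two equalities make the
    integral of [|f - g|] vanish. *)
Lemma ae_eq_integral_superlevel (f g : T -> R) :
  let G := [set w | g w <= f w] in
  measurable G ->
  Q.-integrable setT (EFin \o f) -> Q.-integrable setT (EFin \o g) ->
  (\int[Q]_(w in G) (f w)%:E = \int[Q]_(w in G) (g w)%:E)%E ->
  (\int[Q]_(w in ~` G) (f w)%:E = \int[Q]_(w in ~` G) (g w)%:E)%E ->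
  ae_eq Q setT (EFin \o f) (EFin \o g).
Proof.
move=> G mG intf intg eG eC.
have mC : measurable (~` G) by exact: measurableC.
have iS (D : set T) (k : T -> R) : measurable D -> Q.-integrable setT (EFin \o k) ->
    Q.-integrable D (EFin \o k) by move=> mD; exact: integrableS.
have intd : Q.-integrable setT (EFin \o (fun w => f w - g w)).
  have -> : EFin \o (fun w => f w - g w) = ((EFin \o f) \- (EFin \o g))%E by [].
  exact: integrableB.
have md := measurable_int _ intd.
have zero (D : set T) (k l : T -> R) : measurable D ->
    Q.-integrable setT (EFin \o k) -> Q.-integrable setT (EFin \o l) ->
    (\int[Q]_(w in D) (k w)%:E = \int[Q]_(w in D) (l w)%:E)%E ->
    (\int[Q]_(w in D) (k w - l w)%:E = 0)%E.
  move=> mD ik il e; under eq_integral do rewrite EFinB.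
  rewrite integralB_EFin//; [|exact: iS..].
  by rewrite e subee// integrable_fin_num//; exact: iS.
have abs0 : (\int[Q]_w `|(EFin \o (fun w => f w - g w)%R) w| = 0)%E.
  rewrite -(setUv G) ge0_integral_setU//=; last 2 first.
  - rewrite setUv; apply/measurable_EFinP; apply: measurableT_comp => //.
    exact/measurable_EFinP.
  - by apply/disj_setPS; rewrite setICr.
  rewrite -[RHS](adde0 0%E); congr (_ + _)%E.
  - rewrite -(zero G f g)//; apply: eq_integral => w; rewrite inE => Gw.
    by rewrite ger0_norm// subr_ge0.
  - rewrite -(zero (~` G) g f)//; apply: eq_integral => w; rewrite inE => /= /negP.
    by rewrite -ltNge => fg; rewrite distrC ger0_norm// subr_ge0 ltW.
have /(ae_eq_integral_abs Q measurableT md)[N [mN N0 sN]] := abs0.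
exists N; split => // w wN; apply: sN => h; apply: wN => _.
have e : f w - g w = 0 by apply: EFin_inj; exact: h I.
by rewrite /= -(subrK (g w) (f w)) e add0r.
Qed.

Variables (A : {fset R[i]}) (snr : R) (V W : {RV Q >-> R[i]}).
Hypotheses (A0 : A != fset0) (unifV : uniform_on Q A V) (gaussW : cgaussian Q W)
  (indVW : independent_rv Q V W).

Let s := Num.sqrt snr.
Let Y w := s%:C * V w + W w.

Let A0' : (A : seq R[i]) != [::].
Proof. by rewrite -size_eq0 cardfs_eq0. Qed.

Let mV : measurable_fun setT V. Proof. exact: measurable_funP. Qed.
Let mW : measurable_fun setT W. Proof. exact: measurable_funP. Qed.

Let mY : measurable_fun setT Y. Proof. exact: measurable_channel_output. Qed.

(** The mixture is over the events [V = a], on which the output is the noise translated by [s a]. *)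
Let channel_expectation (F : R[i] -> R[i] -> R) :
  (forall a, quad_growth (F a)) -> measurable_fun setT (fun w => F (V w) (Y w)) ->
  Q.-integrable setT (fun w => (F (V w) (Y w))%:E) /\
  (\int[Q]_w (F (V w) (Y w))%:E =
    ((#|` A|%:R)^-1 * \sum_(a <- A) gauss_mean (s%:C * a) (F a))%:E)%E.
Proof.
move=> qF mF.
pose E (a : R[i]) : set T := V @^-1` [set a].
have mE a : measurable (E a).
  by rewrite -[X in measurable X]setTI; apply: mV => //; exact: (@measurable_set1_complex R).
have [] := @integral_gaussian_mixture _ _ _ Q W mW gaussW R[i] A E
  (fun=> (#|` A|%:R)^-1) (fun a z => F a (z + s%:C * a)) (fun w => F (V w) (Y w)).
- exact: fset_uniq.
- exact: mE.
- by move=> a b _ _ [w [<- <-]].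
- by move=> a aA; exact: unifV.
- rewrite (eq_bigr (fun=> (#|` A|%:R)^-1 * 1)); last by move=> a _; rewrite mulr1.
  by rewrite -mulr_sumr sum1_fset mulVf// pnatr_eq0 cardfs_eq0.
- by move=> a _ D mD; exact: indVW (@measurable_set1_complex R a) mD.
- by move=> a _; exact: quad_growth_shift.
- exact: mF.
- by move=> a w _ <-; rewrite /Y addrC.
move=> iF ->; split => //; rewrite -mulr_sumr; congr (_ * _)%:E.
apply: eq_bigr => a _; rewrite [RHS]gauss_mean_shift; last by have [] := qF a.
by apply: eq_Rintegral => p _; rewrite subr0.
Qed.

Let post y : R[i] := posterior_avg A s Rec y +i* posterior_avg A s Imc y.
Let M0 w := post (Y w).

Let measurable_post : measurable_fun setT post.
Proof. by apply: measurable_fun_complex; exact: measurable_posterior_avg. Qed.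

Let preimageY (G : set T) : g_sigma_algebra_preimage Y G ->
  exists2 D : set R[i], measurable D & G = Y @^-1` D.
Proof. by move=> [D mD <-]; exists D => //; rewrite setTI. Qed.

Let measurable_preimageY (G : set T) : g_sigma_algebra_preimage Y G -> measurable G.
Proof. by move=> [D mD <-]; exact: mY. Qed.

(** The tower property with the indicator of [D] as test function, after writing integrals over the
    preimage of [D] with that indicator as a factor. *)
Let integral_preimageY (g : R[i] -> R) (D : set R[i]) : measurable_fun setT g ->
  measurable D ->
  (\int[Q]_(w in Y @^-1` D) (posterior_avg A s g (Y w))%:E =
   \int[Q]_(w in Y @^-1` D) (g (V w))%:E)%E.
Proof.
move=> mg mD.
have mI : measurable_fun setT (\1_D : R[i] -> R) by exact: measurable_indic.
have qI : quad_growth (\1_D : R[i] -> R).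
  apply: quad_growth_le mI (quad_growth_cst 1) _ => y.
  by rewrite normr1 indicE; case: (_ \in _); rewrite ?normr1 ?normr0.
have restr (k : T -> R) : (\int[Q]_(w in Y @^-1` D) (k w)%:E =
    \int[Q]_w (\1_D (Y w) * k w)%:E)%E.
  rewrite integral_mkcond; apply: eq_integral => w _; rewrite patchE indicE.
  case: ifPn => [|]; rewrite ?inE ?notin_setE /= => Bx.
    by rewrite mem_set// mul1r.
  by rewrite memNset// mul0r.
have mIY : measurable_fun setT (fun w => \1_D (Y w) : R) by exact: measurableT_comp mI mY.
rewrite !restr.
have [_ ->] := @channel_expectation (fun _ y => \1_D y * posterior_avg A s g y)
  (fun=> quad_growth_mul_avg s g A0' qI)
  (measurable_funM mIY (measurableT_comp (measurable_posterior_avg s g A0') mY)).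
under [RHS]eq_integral do rewrite mulrC.
have [_ ->] := @channel_expectation (fun a y => g a * \1_D y)
  (fun a => quad_growthZ (g a) qI)
  (measurable_funM (measurableT_comp mg mV) mIY).
congr (_ * _)%:E; rewrite -(gauss_mean_tower s g A0' qI).
by apply: eq_bigr => a _; rewrite gauss_meanZ.
Qed.

Let integrable_post (g : R[i] -> R) :
  Q.-integrable setT (fun w => (posterior_avg A s g (Y w))%:E).
Proof.
have [] // := @channel_expectation (fun _ y => posterior_avg A s g y).
- by move=> _; exact: quad_growth_posterior_avg.
- exact: measurableT_comp (measurable_posterior_avg s g A0') mY.
Qed.

Let is_cond_expectation_post : is_cond_expectation Q V Y M0.
Proof.
split; [|exact: integrable_post..|].
  move=> _ D mD; exists (post @^-1` D).
    by rewrite -[X in measurable X]setTI; exact: measurable_post.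
  by rewrite !setTI.
move=> G /preimageY[D mD ->].
by split; [exact: (integral_preimageY (@measurable_Re R))|
  exact: (integral_preimageY (@measurable_Im R))].
Qed.

(** Both versions are measurable for the sigma-algebra of [Y], so the set where one component
    dominates the other is an admissible test event, as is its complement. *)
Let cond_expectation_unique (M : T -> R[i]) : is_cond_expectation Q V Y M ->
  ae_eq Q setT (fun w => (complex.Re (M w))%:E) (fun w => (complex.Re (M0 w))%:E) /\
  ae_eq Q setT (fun w => (complex.Im (M w))%:E) (fun w => (complex.Im (M0 w))%:E).
Proof.
have [m0 r0 i0 e0] := is_cond_expectation_post.
move=> [m1 r1 i1 e1].
have superlevel (p : R[i] -> R) : measurable_fun setT p ->
    g_sigma_algebra_preimage Y [set w | p (M0 w) <= p (M w)].
  move=> mp; have := @measurable_fun_ler _ (g_sigma_algebra_preimageType Y) R setT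
    (p \o M0) (p \o M) (measurableT_comp mp m0) (measurableT_comp mp m1).
  by move=> /(_ measurableT [set true] I); rewrite setTI.
have preC (G : set T) : g_sigma_algebra_preimage Y G -> g_sigma_algebra_preimage Y (~` G).
  by move=> /preimageY[D mD ->]; exists (~` D); [exact: measurableC|rewrite setTI].
have uniq (p : R[i] -> R) : measurable_fun setT p ->
    Q.-integrable setT (fun w => (p (M w))%:E) ->
    Q.-integrable setT (fun w => (p (M0 w))%:E) ->
    (forall G, g_sigma_algebra_preimage Y G ->
      (\int[Q]_(w in G) (p (M w))%:E = \int[Q]_(w in G) (p (M0 w))%:E)%E) ->
    ae_eq Q setT (fun w => (p (M w))%:E) (fun w => (p (M0 w))%:E).
  move=> mp j1 j0 e; apply: ae_eq_integral_superlevel => //.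
  - exact/measurable_preimageY/superlevel.
  - exact/e/superlevel.
  - exact/e/preC/superlevel.
split.
- apply: (uniq _ (@measurable_Re R)) => // G GY.
  by rewrite (e1 G GY).1 (e0 G GY).1.
- apply: (uniq _ (@measurable_Im R)) => // G GY.
  by rewrite (e1 G GY).2 (e0 G GY).2.
Qed.

Let error (a y : R[i]) : R := abs2 a * 1
  - 2 * (complex.Re a * posterior_avg A s Rec y + complex.Im a * posterior_avg A s Imc y)
  + (posterior_avg A s Rec y ^+ 2 + posterior_avg A s Imc y ^+ 2).

Let errorE a y : abs2 (a - post y) = error a y.
Proof. by rewrite abs2E /error /post !raddfB /= abs2E; ring. Qed.

(** By the tower property the cross term averages to [-2] times the mean of [|<a>|^2], leaving
    [E|A|^2 - E|<a>|^2]. *)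
Let mmse_error :
  (#|` A|%:R)^-1 * \sum_(a <- A) gauss_mean (s%:C * a) (error a) = mmse A snr.
Proof.
rewrite mmseE//; congr (_ * _).
have qa g := quad_growth_posterior_avg s g A0'.
have qsq g : quad_growth (fun y => posterior_avg A s g y ^+ 2) :=
  quad_growth_mul_avg s g A0' (qa g).
rewrite /error.
transitivity (\sum_(a <- A) (abs2 a
    - 2 * (complex.Re a * gauss_mean (s%:C * a) (posterior_avg A s Rec) +
           complex.Im a * gauss_mean (s%:C * a) (posterior_avg A s Imc))
    + gauss_mean (s%:C * a)
        (fun y => posterior_avg A s Rec y ^+ 2 + posterior_avg A s Imc y ^+ 2))).
  apply: eq_bigr => a _.
  have q2 := quad_growthD (quad_growthZ (complex.Re a) (qa Rec))
    (quad_growthZ (complex.Im a) (qa Imc)).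
  have q1 := quad_growth_cst (abs2 a * 1).
  rewrite gauss_meanD; [|exact: quad_growthB q1 (quad_growthZ 2 q2)|
    exact: quad_growthD (qsq _) (qsq _)].
  rewrite gauss_meanB//; last exact: quad_growthZ.
  rewrite gauss_mean_cst gauss_meanZ// gauss_meanD; [|exact: quad_growthZ..].
  by rewrite !gauss_meanZ// mulr1.
rewrite !big_split/= sumrN -mulr_sumr big_split/=.
rewrite (gauss_mean_tower s Rec A0' (qa Rec)) (gauss_mean_tower s Imc A0' (qa Imc)).
rewrite -/(posterior_energy A s).
have -> : posterior_energy A s =
  \sum_(a <- A) gauss_mean (s%:C * a) (fun y => posterior_avg A s Rec y * posterior_avg A s Rec y) +
  \sum_(a <- A) gauss_mean (s%:C * a) (fun y => posterior_avg A s Imc y * posterior_avg A s Imc y).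
  by rewrite -big_split/=; apply: eq_bigr => a _; rewrite -gauss_meanD//; exact: qsq.
ring.
Qed.

Lemma cond_expectation_mmse :
  (exists M, is_cond_expectation Q V Y M) /\
  (forall M, is_cond_expectation Q V Y M ->
     ('E_Q[fun w => (abs2 (V w - M w))%R])%E = (mmse A snr)%:E).
Proof.
split; first by exists M0; exact: is_cond_expectation_post.
move=> M hM; have [eR eI] := cond_expectation_unique hM; have [_ rM iM _] := hM.
have mabs (N : T -> R[i]) : Q.-integrable setT (fun w => (complex.Re (N w))%:E) ->
    Q.-integrable setT (fun w => (complex.Im (N w))%:E) ->
    measurable_fun setT (fun w => abs2 (V w - N w)).
  move=> /measurable_int/measurable_EFinP mr /measurable_int/measurable_EFinP mi.
  under eq_fun do rewrite abs2E !raddfB /=.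
  by apply: measurable_funD; apply: measurable_funX; apply: measurable_funB => //;
    [exact: measurableT_comp (@measurable_Re R) mV|exact: measurableT_comp (@measurable_Im R) mV].
have m0 : measurable_fun setT (fun w => abs2 (V w - M0 w)) by apply: mabs; exact: integrable_post.
(* Almost sure uniqueness replaces an arbitrary version [M] by the explicit [M0]. *)
rewrite unlock (ae_eq_integral (fun w => (abs2 (V w - M0 w))%:E))//; last first.
- apply: filterS2 eR eI => w /= hR hI _.
  by rewrite !abs2E !raddfB /= (EFin_inj (hR I)) (EFin_inj (hI I)).
- exact/measurable_EFinP.
- by apply/measurable_EFinP; exact: mabs.
have mE : measurable_fun setT (fun w => error (V w) (Y w)).
  by under eq_fun do rewrite -errorE.
have qE a : quad_growth (error a).
  have qa g := quad_growth_posterior_avg s g A0'.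
  apply: quad_growthD; last by apply: quad_growthD; exact: quad_growth_mul_avg (qa _).
  apply: quad_growthB; first exact: quad_growth_cst.
  by apply/quad_growthZ/quad_growthD; exact: quad_growthZ.
under eq_integral do rewrite errorE.
by have [_ ->] := channel_expectation qE mE; rewrite mmse_error.
Qed.

End conditional_mean.

Theorem theorem1 (R : realType) (m : nat) (hm : (1 <= m)%N)
    (X : {fset R[i]}) (hX : #|` X| = (2 ^ m)%N)
    (label : X -> m.-tuple bool) (hlabel : bijective label)
    (d : measure_display) (T : 'I_m -> measurableType d)
    (P : forall i, probability (T i) R)
    (B : forall i, {RV (P i) >-> bool})
    (S Z : forall i, {RV (P i) >-> R[i]})
    (hBSZ : forall i, bicm_inputs label (P i) i (B i) (S i) (Z i)) :
  (forall snr : R, 0 < snr ->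
    is_derive snr 1 (bicm_mutual_info label P B S Z)
      (\sum_(i < m) 2^-1 *
         \sum_(b : bool) (mmse X snr - mmse (subconstellation label i b) snr))) /\
  (forall (A : {fset R[i]}) (snr : R), A != fset0 -> 0 < snr ->
    forall (d' : measure_display) (T' : measurableType d') (Q : probability T' R)
      (V W : {RV Q >-> R[i]}),
    uniform_on Q A V -> cgaussian Q W -> independent_rv Q V W ->
    let Y := fun w => (Num.sqrt snr)%:C * V w + W w in
    (exists M, is_cond_expectation Q V Y M) /\
    (forall M, is_cond_expectation Q V Y M ->
       ('E_Q[fun w => (abs2 (V w - M w))%R])%E = (mmse A snr)%:E)).
Proof.
split=> [snr snr0|A snr A0 _ d' T' Q V W unifV gaussW indVW Y].
  rewrite (_ : bicm_mutual_info _ _ _ _ _ =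
    \sum_(i < m) bicm_term label (P i) i (B i) (S i) (Z i)); last first.
    by apply/funext => t; rewrite fct_sumE.
  by apply: is_derive_sum => i; exact: is_derive_bicm_term.
exact: cond_expectation_mmse.
Qed.
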